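(* Let $D$ be a $2$-dimensional regular local ring with maximal ideal $\mathfrak{m}_D=(x,y)D$ and with an algebraically closed coefficient field $k$. For each $a\in k$ let $$\alpha_a=D\Big[\tfrac{x+ay}{y}\Big]_{(y,\frac{x+ay}{y})},\qquad \beta_a=\alpha_a\Big[\tfrac{y^2}{x+ay}\Big]_{(\frac{x+ay}{y},\frac{y^2}{x+ay})},$$ (localizations at the ideals generated by the indicated elements), and let $B=\bigcap_{a\in k}\beta_a$. Then $B$ is an almost Krull domain that is not Noetherian, and the family $\{\beta_a: a\in k\}$ defines an irredundant essential representation of $B$.
   Context: A coefficient field of $D$ is a subfield $k\subseteq D$ mapping isomorphically onto $D/\mathfrak{m}_D$. An integral domain $B$ is an almost Krull domain if $B_P$ is a Krull domain for every prime ideal $P$ of $B$. The representation $B=\bigcap_{a\in k}\beta_a$ is irredundant if for every $b\in k$, $\bigcap_{a\neq b}\beta_a\neq B$; it is essential if each $\beta_a$ is a localization of $B$ at a prime ideal of $B$. *)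

(* Defs.v *)
(* All rings are represented as subrings of a fixed field K
   (the fraction field of D), given as predicates K -> Prop. *)
From Stdlib Require List.
From HB Require Import structures.
From mathcomp Require Import all_boot all_order all_algebra.
Set Implicit Arguments. Unset Strict Implicit. Unset Printing Implicit Defensive.
Import Order.TTheory GRing.Theory Num.Theory.
Local Open Scope ring_scope.

Section Defs.
Variable K : fieldType.
Implicit Types (R I F k : K -> Prop).

Definition is_subring R : Prop :=
  [/\ R 0, R 1, (forall a b, R a -> R b -> R (a - b)) &
      (forall a b, R a -> R b -> R (a * b))].

Definition frac R : K -> Prop :=
  fun z => exists a b, [/\ R a, R b, b != 0 & z = a / b].

Definition is_ideal R I : Prop :=
  [/\ (forall z, I z -> R z), I 0, (forall a b, I a -> I b -> I (a + b)) &
      (forall r a, R r -> I a -> I (r * a))].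

Definition is_prime_ideal R I : Prop :=
  [/\ is_ideal R I, ~ I 1 &
      (forall a b, R a -> R b -> I (a * b) -> I a \/ I b)].

Definition ideal_gen R (s : seq K) : K -> Prop :=
  fun z => exists c : seq K, [/\ size c = size s, (forall r, List.In r c -> R r) &
                              z = \sum_(i < size s) c`_i * s`_i].

Definition ideal2 R (g1 g2 : K) : K -> Prop := ideal_gen R [:: g1; g2].

Definition is_noetherian R : Prop :=
  is_subring R /\
  forall I, is_ideal R I ->
    exists s : seq K, (forall g, List.In g s -> R g) /\
                      (forall z, I z <-> ideal_gen R s z).

Definition prime_lt R (P Q : K -> Prop) : Prop :=
  [/\ is_prime_ideal R P, is_prime_ideal R Q, (forall z, P z -> Q z) &
      (exists z, Q z /\ ~ P z)].

Definition krull_dim_eq2 R : Prop :=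
  (exists P0 P1 P2, prime_lt R P0 P1 /\ prime_lt R P1 P2) /\
  ~ (exists P0 P1 P2 P3, [/\ prime_lt R P0 P1, prime_lt R P1 P2 & prime_lt R P2 P3]).

Definition is_local_with_max R m : Prop :=
  is_ideal R m /\ forall d, R d -> (m d <-> ~ (d != 0 /\ R d^-1)).

Definition regular_local_dim2 (D : K -> Prop) (x y : K) : Prop :=
  [/\ is_noetherian D, (forall z, frac D z), D x /\ D y,
      is_local_with_max D (ideal2 D x y) & krull_dim_eq2 D].

Definition is_subfield k : Prop :=
  is_subring k /\ forall a, k a -> a != 0 -> k a^-1.

Definition alg_closed_sub k : Prop :=
  forall p : {poly K}, (forall i, k p`_i) -> (1 < size p)%N ->
    exists c, k c /\ root p c.

Definition coefficient_field (D m k : K -> Prop) : Prop :=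
  [/\ is_subfield k, (forall c, k c -> D c),
      (forall d, D d -> exists c, k c /\ m (d - c)) &
      (forall c, k c -> m c -> c = 0)].

Definition adjoin R (t : K) : K -> Prop :=
  fun z => exists p : {poly K}, (forall i, R p`_i) /\ z = p.[t].

Definition localize R I : K -> Prop :=
  fun z => exists r s, [/\ R r, R s, ~ I s & z = r / s].

Definition is_dval (F : K -> Prop) (v : K -> int) : Prop :=
  [/\ (forall a b, F a -> F b -> a != 0 -> b != 0 -> v (a * b) = v a + v b),
      (forall a b, F a -> F b -> a != 0 -> b != 0 -> a + b != 0 ->
         Num.min (v a) (v b) <= v (a + b)) &
      (exists t, [/\ F t, t != 0 & v t = 1])].

Definition is_krull R : Prop :=
  is_subring R /\
  exists (I : Type) (v : I -> K -> int),
    [/\ (forall i, is_dval (frac R) (v i)),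
        (forall z, R z <-> frac R z /\ forall i, z = 0 \/ 0 <= v i z) &
        (forall z, frac R z -> z != 0 ->
           exists s : seq I, forall i, v i z != 0 -> List.In i s)].

Definition almost_krull R : Prop :=
  is_subring R /\ forall P, is_prime_ideal R P -> is_krull (localize R P).

Definition alpha (D : K -> Prop) (x y a : K) : K -> Prop :=
  let u := (x + a * y) / y in
  localize (adjoin D u) (ideal2 (adjoin D u) y u).

Definition beta (D : K -> Prop) (x y a : K) : K -> Prop :=
  let u := (x + a * y) / y in
  let w := y ^+ 2 / (x + a * y) in
  localize (adjoin (alpha D x y a) w) (ideal2 (adjoin (alpha D x y a) w) u w).

End Defs.

(* Main.v *)
Require Import Defs.
From Stdlib Require List.
From mathcomp Require Import all_boot all_order all_algebra.
From mathcomp Require Import boolp classical_sets.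
From mathcomp Require Import ring zify.
Set Implicit Arguments. Unset Strict Implicit. Unset Printing Implicit Defensive.
Import Order.TTheory GRing.Theory Num.Theory.
Local Open Scope ring_scope.

(** Write t = x/y, u_a = t + a and w_a = y/u_a. If R is a two-dimensional regular local ring with
parameters p, q and coefficient field k, so is R[q/p] localized at (p, q/p), because R[q/p]/(p) is
the polynomial ring k[T] and R[q/p]/(q/p) = R/(q). Hence beta_a is a two-dimensional regular local
ring with parameters u_a, w_a. Such a ring is factorial: if r is irreducible and not divisible by
the parameter u, then an ideal (r : a) is principal modulo u, hence principal by Nakayama.

All beta_a lie in the valuation ring V of the order valuation, the localization of D[t] at (y),
whose residue field is k(t). The residue of an element of B has no pole at any point -a of the
affine line, so it is a polynomial, B/(B cap yV) = k[t], and an element of B whose residue is a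
nonzero constant is a unit in every beta_a. Thus the maximal ideals of B are the centers M_a of
the beta_a, one for each point of the line, and since u_a and w_a are in B, B localized at M_a is
beta_a. So every localization of B at a prime is a localization of some factorial beta_a, hence
Krull. The element 1/u_b belongs to beta_a exactly for a <> b, and the elements of B divisible by
y in almost all beta_a form an ideal containing all w_b = y (1/u_b), hence not finitely
generated. *)

(** * Subrings and ideals *)

Section Subring.
Variables (K : fieldType) (R : K -> Prop) (subR : is_subring R).

Lemma subring0 : R 0. Proof. by case: subR. Qed.

Lemma subring1 : R 1. Proof. by case: subR. Qed.

Lemma subringB a b : R a -> R b -> R (a - b).
Proof. by case: subR => _ _ + _; apply. Qed.

Lemma subringM a b : R a -> R b -> R (a * b).
Proof. by case: subR => _ _ _; apply. Qed.

Lemma subringN a : R a -> R (- a).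
Proof. by rewrite -sub0r; apply: subringB; apply: subring0. Qed.

Lemma subringD a b : R a -> R b -> R (a + b).
Proof. by move=> Ra Rb; rewrite -[b]opprK; apply/subringB/subringN. Qed.

Lemma subringX a n : R a -> R (a ^+ n).
Proof.
move=> Ra; elim: n => [|n IH]; first by rewrite expr0; apply: subring1.
by rewrite exprS; apply: subringM.
Qed.

Lemma subring_sum (T : Type) (r : seq T) (P : pred T) (F : T -> K) :
  (forall i, P i -> R (F i)) -> R (\sum_(i <- r | P i) F i).
Proof. by move=> RF; apply: big_ind => //; [apply: subring0 | apply: subringD]. Qed.

Lemma subring_prod (T : Type) (r : seq T) (P : pred T) (F : T -> K) :
  (forall i, P i -> R (F i)) -> R (\prod_(i <- r | P i) F i).
Proof. by move=> RF; apply: big_ind => //; [apply: subring1 | apply: subringM]. Qed.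

End Subring.

Ltac in_subring subR :=
  intros; repeat first [assumption | apply: (subring0 subR) | apply: (subring1 subR)
    | apply: (subringD subR) | apply: (subringN subR) | apply: (subringM subR)
    | apply: (subringX subR)].

Section UnitsAndDivisibility.
Variable K : fieldType.
Implicit Types (R : K -> Prop) (a b c e p : K).

Definition unit_in R e : Prop := [/\ R e, e != 0 & R e^-1].

Definition dvd_in R a b : Prop := exists2 c, R c & b = a * c.

Definition prime_in R p : Prop :=
  [/\ R p, p != 0, ~ dvd_in R p 1 &
      forall a b, R a -> R b -> dvd_in R p (a * b) -> dvd_in R p a \/ dvd_in R p b].

Definition irreducible_in R r : Prop :=
  [/\ R r, ~ unit_in R r &
      forall a b, R a -> R b -> r = a * b -> unit_in R a \/ unit_in R b].

Variables (R : K -> Prop) (subR : is_subring R).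

Lemma unit_in1 : unit_in R 1.
Proof. by split; rewrite ?invr1 ?oner_neq0 //; in_subring subR. Qed.

Lemma unit_inM a b : unit_in R a -> unit_in R b -> unit_in R (a * b).
Proof.
by move=> [Ra a0 Ra'] [Rb b0 Rb']; split; rewrite ?invfM ?mulf_neq0 //; in_subring subR.
Qed.

Lemma unit_inV a : unit_in R a -> unit_in R a^-1.
Proof. by move=> [Ra a0 Ra']; split; rewrite ?invrK ?invr_eq0. Qed.

Lemma dvd_in_refl a : dvd_in R a a.
Proof. by exists 1; [in_subring subR | rewrite mulr1]. Qed.

Lemma dvd_in_mulr a c : R c -> dvd_in R a (a * c).
Proof. by exists c. Qed.

Lemma dvd_in0 a : dvd_in R a 0.
Proof. by exists 0; [in_subring subR | rewrite mulr0]. Qed.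

Lemma dvd_inD a b c : dvd_in R a b -> dvd_in R a c -> dvd_in R a (b + c).
Proof. by move=> [d Rd ->] [e Re ->]; exists (d + e); [in_subring subR | rewrite mulrDr]. Qed.

Lemma dvd_inMr a b c : R c -> dvd_in R a b -> dvd_in R a (b * c).
Proof. by move=> Rc [d Rd ->]; exists (d * c); [in_subring subR | rewrite mulrA]. Qed.

Lemma dvd_inMl a b c : R c -> dvd_in R a b -> dvd_in R a (c * b).
Proof. by rewrite mulrC; apply: dvd_inMr. Qed.

Lemma dvd_inB a b c : dvd_in R a b -> dvd_in R a c -> dvd_in R a (b - c).
Proof.
by move=> ab ac; rewrite -mulN1r; apply: dvd_inD => //; apply: dvd_inMl => //; in_subring subR.
Qed.

Lemma dvd_in_trans a b c : dvd_in R a b -> dvd_in R b c -> dvd_in R a c.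
Proof. by move=> ab [d Rd ->]; apply: dvd_inMr. Qed.

Lemma dvd_in_unit_mull a e b : unit_in R e -> dvd_in R a (e * b) -> dvd_in R a b.
Proof. by move=> [Re e0 Re'] /(dvd_inMl Re'); rewrite mulKf. Qed.

Lemma dvd_in1_unit e : R e -> dvd_in R e 1 -> unit_in R e.
Proof.
move=> Re [c Rc ec]; have e0 : e != 0.
  by apply/eqP => e0; move/eqP: ec; rewrite e0 mul0r oner_eq0.
by split=> //; rewrite -[e^-1]mulr1 ec mulKf.
Qed.

Lemma prime_in_dvdX p a n : prime_in R p -> R a -> dvd_in R p (a ^+ n) -> dvd_in R p a.
Proof.
move=> [_ _ np1 prp] Ra; elim: n => [|n IH]; first by rewrite expr0.
by rewrite exprS => /prp [|||/IH] //; in_subring subR.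
Qed.

Lemma prime_in_ndvdM p a b : prime_in R p -> R a -> R b ->
  ~ dvd_in R p a -> ~ dvd_in R p b -> ~ dvd_in R p (a * b).
Proof. by move=> [_ _ _ prp] Ra Rb pa pb /prp []. Qed.

Lemma prime_in_dvd_prime p q : prime_in R p -> prime_in R q -> dvd_in R p q ->
  exists2 e, unit_in R e & q = p * e.
Proof.
move=> [Rp p0 np1 _] [_ q0 _ prq] [e Re qE]; exists e => //; apply: dvd_in1_unit => //.
have [||//|[c Rc pE]|[c Rc eE]] := prq p e => //; first by rewrite -qE; apply: dvd_in_refl.
  by exists c => //; apply: (mulfI p0); rewrite mulrA -qE -pE mulr1.
by case: np1; exists c => //; apply: (mulfI q0); rewrite mulrCA -eE -qE mulr1.
Qed.

End UnitsAndDivisibility.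

Section Ideals.
Variables (K : fieldType) (R : K -> Prop) (subR : is_subring R).
Implicit Types (I : K -> Prop) (a b c g z : K) (s : seq K).

Section Closure.
Variables (I : K -> Prop) (idI : is_ideal R I).

Lemma ideal_mem z : I z -> R z. Proof. by case: idI => + _ _ _; apply. Qed.

Lemma ideal0 : I 0. Proof. by case: idI. Qed.

Lemma idealD a b : I a -> I b -> I (a + b).
Proof. by case: idI => _ _ + _; apply. Qed.

Lemma idealZl r a : R r -> I a -> I (r * a).
Proof. by case: idI => _ _ _; apply. Qed.

Lemma idealZr r a : R r -> I a -> I (a * r).
Proof. by rewrite mulrC; apply: idealZl. Qed.

Lemma idealB a b : I a -> I b -> I (a - b).
Proof. by move=> Ia Ib; rewrite -mulN1r; apply/idealD/idealZl => //; in_subring subR. Qed.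

Lemma ideal_unit_mull e a : unit_in R e -> I (e * a) -> I a.
Proof. by move=> [Re e0 Re'] /(idealZl Re'); rewrite mulKf. Qed.

Lemma ideal_unit e : unit_in R e -> I e -> I 1.
Proof. by move=> Ue Ie; apply: (ideal_unit_mull Ue); rewrite mulr1. Qed.

End Closure.

Lemma ideal_notin_neq0 I a : is_ideal R I -> ~ I a -> a != 0.
Proof. by move=> idI Ia; apply/eqP => a0; apply: Ia; rewrite a0; apply: (ideal0 idI). Qed.

Lemma prime_ideal_notM I a b : is_prime_ideal R I -> R a -> R b ->
  ~ I a -> ~ I b -> ~ I (a * b).
Proof. by move=> [_ _ prI] Ra Rb Ia Ib /prI []. Qed.

Lemma prime_ideal_exp I a n : is_prime_ideal R I -> R a -> I (a ^+ n) -> I a.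
Proof.
move=> [_ I1 prI] Ra; elim: n => [|n IH]; first by rewrite expr0.
by rewrite exprS => /prI [|||/IH] //; in_subring subR.
Qed.

Lemma dvd_in_ideal a : R a -> is_ideal R (dvd_in R a).
Proof.
move=> Ra; split=> [_ [c Rc ->]||b c|r b]; first by in_subring subR.
- exact: dvd_in0.
- exact: dvd_inD.
- exact: dvd_inMl.
Qed.

Lemma dvd_in_prime_ideal p : prime_in R p -> is_prime_ideal R (dvd_in R p).
Proof. by move=> [Rp _ np1 prp]; split=> //; apply: dvd_in_ideal. Qed.

Definition colon I a : K -> Prop := fun z => R z /\ I (a * z).

Lemma colon_ideal I a : is_ideal R I -> is_ideal R (colon I a).
Proof.
move=> idI; split.
- by move=> z [].
- by split; [in_subring subR | rewrite mulr0; apply: (ideal0 idI)].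
- by move=> b c [Rb Ib] [Rc Ic]; split; [in_subring subR | rewrite mulrDr; apply: idealD Ib Ic].
- by move=> r b Rr [Rb Ib]; split; [in_subring subR | rewrite mulrCA; apply: idealZl Ib].
Qed.

Definition ideal_add I g : K -> Prop := fun z => exists2 c, R c & I (z - c * g).

Lemma ideal_addl I g z : I z -> ideal_add I g z.
Proof. by exists 0; [in_subring subR | rewrite mul0r subr0]. Qed.

Lemma ideal_add_ideal I g : is_ideal R I -> R g -> is_ideal R (ideal_add I g).
Proof.
move=> idI Rg; split.
- by move=> z [c Rc /(ideal_mem idI) Rz]; rewrite -(subrK (c * g) z); in_subring subR.
- exact/ideal_addl/(ideal0 idI).
- move=> a b [c Rc Ia] [d Rd Ib]; exists (c + d); first by in_subring subR.
  by rewrite mulrDl opprD addrACA; apply: idealD Ia Ib.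
- move=> r a Rr [c Rc Ia]; exists (r * c); first by in_subring subR.
  by rewrite -mulrA -mulrBr; apply: (idealZl idI).
Qed.

Lemma ideal_gen_nil z : ideal_gen R [::] z <-> z = 0.
Proof.
split=> [[c [_ _ ->]]|->]; first by rewrite big_ord0.
by exists [::]; split=> //; rewrite big_ord0.
Qed.

Lemma ideal_gen_cons g s z :
  ideal_gen R (g :: s) z <-> exists2 c, R c & ideal_gen R s (z - c * g).
Proof.
split=> [[[|a c] [//= [sc] Rc ->]]|[a Ra [c [sc Rc zE]]]].
  exists a; first by apply: Rc; left.
  exists c; split=> //; first by move=> r cr; apply: Rc; right.
  by rewrite big_ord_recl /= addrC addKr.
exists (a :: c); split=> /=; first by rewrite sc.
  by move=> r [<-|/Rc].
by rewrite big_ord_recl /= -[RHS]/(a * g + \sum_(i < size s) c`_i * s`_i) -zE addrC subrK.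
Qed.

Lemma ideal_gen_ideal s : (forall g, List.In g s -> R g) -> is_ideal R (ideal_gen R s).
Proof.
elim: s => [|g s IH] Rs.
  have -> : ideal_gen R [::] = dvd_in R 0.
    apply/predeqP => z; rewrite ideal_gen_nil; split=> [->|[c _ ->]]; last exact: mul0r.
    exact: dvd_in0.
  by apply: dvd_in_ideal; in_subring subR.
have -> : ideal_gen R (g :: s) = ideal_add (ideal_gen R s) g.
  by apply/predeqP => z; apply: ideal_gen_cons.
apply: ideal_add_ideal; last by apply: Rs; left.
by apply: IH => h hs; apply: Rs; right.
Qed.

Lemma ideal_gen_mem s g : (forall h, List.In h s -> R h) -> List.In g s -> ideal_gen R s g.
Proof.
elim: s => //= h s IH Rs [<-|gs]; apply/ideal_gen_cons.
  exists 1; rewrite ?mul1r ?subrr; first by in_subring subR.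
  by apply: ideal0 (ideal_gen_ideal _) => h' h's; apply: Rs; right.
exists 0; first by in_subring subR.
by rewrite mul0r subr0; apply: IH => // h' h's; apply: Rs; right.
Qed.

Lemma ideal_gen_least s I z :
  is_ideal R I -> (forall g, List.In g s -> I g) -> ideal_gen R s z -> I z.
Proof.
move=> idI; elim: s z => [|g s IH] z Is; first by move=> /ideal_gen_nil ->; apply: (ideal0 idI).
move=> /ideal_gen_cons [c Rc sz]; rewrite -(subrK (c * g) z); apply: (idealD idI).
  by apply: IH sz => h hs; apply: Is; right.
by apply: idealZl => //; apply: Is; left.
Qed.

Lemma ideal_gen_mono (R' : K -> Prop) s z :
  (forall r, R r -> R' r) -> ideal_gen R s z -> ideal_gen R' s z.
Proof. by move=> RR' [c [sc Rc ->]]; exists c; split=> // r /Rc /RR'. Qed.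

Lemma ideal2P p q z : ideal2 R p q z <-> exists a b, [/\ R a, R b & z = a * p + b * q].
Proof.
rewrite /ideal2 ideal_gen_cons; split=> [[a Ra /ideal_gen_cons [b Rb /ideal_gen_nil zE]]|].
  by exists a, b; split=> //; apply/eqP; rewrite -subr_eq0 opprD addrA zE.
move=> [a [b [Ra Rb ->]]]; exists a => //; apply/ideal_gen_cons; exists b => //.
by apply/ideal_gen_nil; ring.
Qed.

Lemma ideal2C p q : ideal2 R p q = ideal2 R q p.
Proof.
apply/predeqP => z; rewrite !ideal2P.
by split=> -[a [b [Ra Rb ->]]]; exists b, a; rewrite addrC.
Qed.

Lemma ideal2_translate p q c : R c -> ideal2 R p (q + c * p) = ideal2 R p q.
Proof.
move=> Rc; apply/predeqP => z; rewrite !ideal2P; split=> -[a [b [Ra Rb ->]]].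
  by exists (a + b * c), b; split; [in_subring subR | by [] | ring].
by exists (a - b * c), b; split; [in_subring subR | by [] | ring].
Qed.

Lemma ideal2_ideal p q : R p -> R q -> is_ideal R (ideal2 R p q).
Proof. by move=> Rp Rq; apply: ideal_gen_ideal => g [<-|[<-|]]. Qed.

Lemma dvd_in_ideal2l p q z : dvd_in R p z -> ideal2 R p q z.
Proof.
move=> [c Rc ->]; apply/ideal2P; exists c, 0.
by split; rewrite // ?mul0r ?addr0 1?mulrC //; in_subring subR.
Qed.

Lemma dvd_in_ideal2r p q z : dvd_in R q z -> ideal2 R p q z.
Proof. by rewrite ideal2C; apply: dvd_in_ideal2l. Qed.

Lemma ideal2l p q : ideal2 R p q p.
Proof. exact/dvd_in_ideal2l/dvd_in_refl. Qed.

Lemma ideal2r p q : ideal2 R p q q.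
Proof. exact/dvd_in_ideal2r/dvd_in_refl. Qed.

Lemma ideal2_least p q I z : is_ideal R I -> I p -> I q -> ideal2 R p q z -> I z.
Proof. by move=> idI Ip Iq; apply: ideal_gen_least => // g [<-|[<-|]]. Qed.

Lemma ideal2_exp u w z n : R u -> R w -> ideal2 R u w z -> ideal2 R u (w ^+ n) (z ^+ n).
Proof.
move=> Ru Rw mz; have Rz := ideal_mem (ideal2_ideal Ru Rw) mz.
have [a [b [Ra Rb zE]]] := (ideal2P _ _ _).1 mz; apply/ideal2P.
elim: n => [|n [c [d [Rc Rd IH]]]].
  by exists 0, 1; rewrite !expr0; split; try in_subring subR; ring.
exists (z * c + a * (d * w ^+ n)), (b * d); split; try by in_subring subR.
by rewrite exprS IH mulrDr {2}zE exprS; ring.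
Qed.

End Ideals.

Section FinitelyGenerated.
Variables (K : fieldType) (R : K -> Prop) (subR : is_subring R).
Implicit Types (J N : K -> Prop).

Definition fin_gen J : Prop := exists s : seq K,
  (forall g, List.In g s -> J g) /\ (forall z, J z -> ideal_gen R s z).

Lemma noetherian_fin_gen J : is_noetherian R -> is_ideal R J -> fin_gen J.
Proof.
move=> [_ nR] idJ; have [s [Rs Js]] := nR J idJ; exists s; split=> [g gs|z /Js //].
exact/Js/ideal_gen_mem.
Qed.

Lemma fin_gen_noetherian : (forall J, is_ideal R J -> fin_gen J) -> is_noetherian R.
Proof.
move=> fgR; split=> // J idJ; have [s [Js sJ]] := fgR J idJ; exists s.
split=> [g /Js|z]; first exact: (ideal_mem idJ).
by split=> [/sJ //|]; apply: ideal_gen_least.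
Qed.

Section DirectedUnion.
Variables (T : Type) (J : T -> K -> Prop) (i0 : T).
Hypothesis idJ : forall i, is_ideal R (J i).
Hypothesis dirJ : forall i j, exists l, (forall z, J i z -> J l z) /\ (forall z, J j z -> J l z).

Lemma directed_union_ideal : is_ideal R (fun z => exists i, J i z).
Proof.
split.
- by move=> z [i /(ideal_mem (idJ i))].
- by exists i0; apply: ideal0 (idJ i0).
- move=> a b [i Ja] [j Jb]; have [l [il jl]] := dirJ i j.
  by exists l; apply: (idealD (idJ l)); [apply: il | apply: jl].
- by move=> r a Rr [i Ja]; exists i; apply: (idealZl (idJ i)).
Qed.

Lemma fin_gen_directed_union :
  fin_gen (fun z => exists i, J i z) -> exists i, forall j z, J j z -> J i z.
Proof.
move=> [s [Js sJ]]; suff [i Ji] : exists i, forall g, List.In g s -> J i g.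
  by exists i => j z Jz; apply: ideal_gen_least (idJ i) Ji _; apply: sJ; exists j.
elim: s Js {sJ} => [|g s IH] Js; first by exists i0.
have [|i Ji] := IH; first by move=> h hs; apply: Js; right.
have [|j Jg] := Js g; first by left.
have [l [il jl]] := dirJ i j; exists l => h [<-|hs]; [exact: jl | exact/il/Ji].
Qed.

End DirectedUnion.

Definition in_jacobson u : Prop := forall c, R c -> unit_in R (1 - u * c).

Lemma nakayama u N J : R u -> in_jacobson u -> is_ideal R N -> is_ideal R J -> fin_gen J ->
  (forall z, J z -> exists2 j, J j & N (z - u * j)) -> forall z, J z -> N z.
Proof.
move=> Ru jac idN idJ [s [Js sJ]].
have {sJ} : forall z, J z -> exists2 n, N n & ideal_gen R s (z - n).
  by move=> z /sJ sz; exists 0; rewrite ?subr0 //; apply: (ideal0 idN).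
elim: s N idN Js => [|g s IH] N idN Js sJ JN z Jz.
  by have [n Nn /ideal_gen_nil /eqP] := sJ z Jz; rewrite subr_eq0 => /eqP ->.
have Jg : J g by apply: Js; left.
have JNg : forall z, J z -> ideal_add R N g z.
  apply: IH.
  - exact: (ideal_add_ideal subR idN (ideal_mem idJ Jg)).
  - by move=> h hs; apply: Js; right.
  - move=> v /sJ [n Nn /ideal_gen_cons [c Rc sz]]; exists (n + c * g); last by rewrite opprD addrA.
    by exists c => //; rewrite addrK.
  - by move=> v /JN [j Jj Nz]; exists j => //; apply: ideal_addl.
have [j Jj Ngj] := JN g Jg; have [c Rc Njg] := JNg j Jj.
have Ng : N g.
  apply: (ideal_unit_mull idN (jac c Rc)).
  have -> : (1 - u * c) * g = (g - u * j) + u * (j - c * g) by ring.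
  by apply: (idealD idN) => //; apply: (idealZl idN).
have [d Rd Nzg] := JNg z Jz.
by rewrite -(subrK (d * g) z); apply: (idealD idN) => //; apply: (idealZl idN).
Qed.

Hypothesis noethR : is_noetherian R.

Lemma krull_intersection w N z : R w -> in_jacobson w -> is_ideal R N ->
  (forall c, R c -> N (w * c) -> N c) ->
  R z -> (forall n, ideal_add R N (w ^+ n) z) -> N z.
Proof.
move=> Rw jac idN regw Rz capz; pose J v := R v /\ forall n, ideal_add R N (w ^+ n) v.
have idJ : is_ideal R J.
  have idNw n := ideal_add_ideal subR idN (subringX subR n Rw).
  split=> [v []//||a b [Ra Ja] [Rb Jb]|r a Rr [Ra Ja]].
  - by split=> [|n]; [in_subring subR | apply: (ideal0 (idNw n))].
  - by split=> [|n]; [in_subring subR | apply: (idealD (idNw n))].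
  - by split=> [|n]; [in_subring subR | apply: (idealZl (idNw n))].
apply: (nakayama Rw jac idN idJ (noetherian_fin_gen noethR idJ)) (conj Rz capz).
move=> v [Rv Jv]; have [c Rc Nvc] := Jv 1%N; rewrite expr1 mulrC in Nvc.
exists c => //; split=> // n; have [d Rd Nvd] := Jv n.+1.
exists d => //; apply: regw; first by in_subring subR.
have -> : w * (c - d * w ^+ n) = (v - d * w ^+ n.+1) - (v - w * c) by rewrite exprS; ring.
by apply: (idealB subR idN).
Qed.

Lemma in_jacobson_multiplicity u r : R u -> u != 0 -> in_jacobson u -> R r -> r != 0 ->
  exists n r', [/\ R r', ~ dvd_in R u r' & r = u ^+ n * r'].
Proof.
move=> Ru u0 jac Rr /eqP r0; apply: contrapT => no; apply: r0.
suff [c _ ->] : dvd_in R 0 r by rewrite mul0r.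
have R0 := subring0 subR.
apply: (krull_intersection Ru jac (dvd_in_ideal subR R0)) => //.
  move=> c Rc [d _ /eqP]; rewrite mul0r mulf_eq0 (negPf u0) => /eqP ->; exact: dvd_in0.
move=> n; elim: n => [|n [c Rc [d Rd]]].
  by exists r => //; rewrite expr0 mulr1 subrr; apply: dvd_in0.
rewrite mul0r => /eqP; rewrite subr_eq0 => /eqP rE.
have [e Re cE] : dvd_in R u c.
  by apply: contrapT => nc; apply: no; exists n, c; rewrite mulrC.
by exists e => //; rewrite rE cE exprS; exists 0; [|ring].
Qed.

End FinitelyGenerated.

(** * Local rings whose maximal ideal has two generators *)

Section LocalRing.
Variables (K : fieldType) (R m : K -> Prop) (subR : is_subring R).

Lemma local_with_max_intro : is_ideal R m -> ~ m 1 ->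
  (forall r, R r -> ~ m r -> unit_in R r) -> is_local_with_max R m.
Proof.
move=> idm m1 unitR; split=> // d Rd; split=> [md [d0 Rd']|nU].
  by apply: m1; apply: (ideal_unit idm _ md).
by apply: contrapT => nmd; apply: nU; have [] := unitR d Rd nmd.
Qed.

Hypothesis locR : is_local_with_max R m.

Lemma local_ideal : is_ideal R m. Proof. by case: locR. Qed.

Lemma local_not_unit z : m z -> ~ unit_in R z.
Proof. by move=> mz [Rz z0 Rz']; case: locR => _ /(_ z Rz) [+ _] => /(_ mz); apply. Qed.

Lemma local_unit r : R r -> ~ m r -> unit_in R r.
Proof.
move=> Rr mr; apply: contrapT => nU; apply: mr.
by case: locR => _ /(_ r Rr) [_]; apply=> -[r0 Rr']; apply: nU.
Qed.

Lemma local_not1 : ~ m 1.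
Proof. by move/local_not_unit; apply; apply: unit_in1. Qed.

Lemma local_unitD e z : unit_in R e -> m z -> unit_in R (e + z).
Proof.
move=> Ue mz; have idm := local_ideal; apply: local_unit.
  by have [Re _ _] := Ue; have Rz := ideal_mem idm mz; in_subring subR.
move=> mez; apply: local_not_unit Ue.
by rewrite -(addrK z e); apply: (idealB subR idm).
Qed.

Lemma local_jacobson z : m z -> in_jacobson R z.
Proof.
move=> mz c Rc; apply: local_unitD; first exact: unit_in1.
by rewrite -mulrN mulrC; apply: (idealZl local_ideal) => //; in_subring subR.
Qed.

End LocalRing.

Section OrderModulo.
Variables (K : fieldType) (R : K -> Prop) (u w : K).
Hypotheses (subR : is_subring R) (Ru : R u) (Rw : R w).

Definition order_mod r j : Prop := exists e c, [/\ unit_in R e, R c & r = e * w ^+ j + u * c].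

(** The ideals of [R/uR] are then generated by powers of [w], hence form a chain. *)
Definition uniserial_mod : Prop := forall r, R r -> dvd_in R u r \/ exists j, order_mod r j.

Lemma order_modM r s i j : order_mod r i -> order_mod s j -> order_mod (r * s) (i + j).
Proof.
move=> [e [c [Ue Rc ->]]] [f [d [Uf Rd ->]]].
have [[Re _ _] [Rf _ _]] := (Ue, Uf).
exists (e * f), (c * (f * w ^+ j + u * d) + e * w ^+ i * d).
by split; [exact: unit_inM | in_subring subR | rewrite exprD; ring].
Qed.

Hypothesis ndvdX : forall n, ~ dvd_in R u (w ^+ n).

Lemma order_mod_ndvd r j : order_mod r j -> ~ dvd_in R u r.
Proof.
move=> [e [c [Ue Rc ->]]] ur; apply: (ndvdX (n := j)).
apply: (dvd_in_unit_mull subR Ue); rewrite -(addrK (u * c) (e * _)).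
by apply: dvd_inB => //; apply: dvd_in_mulr.
Qed.

Lemma order_mod_uniq r i j : in_jacobson R w -> order_mod r i -> order_mod r j -> i = j.
Proof.
move=> jac; wlog lt_ij : i j / (i < j)%N => [uniq ri rj|].
  by have [lt_ij|lt_ji|//] := ltngtP i j; [apply: uniq | apply/esym/uniq].
move=> [e [c [[Re e0 Re'] Rc rE]]] [f [d [[Rf _ _] Rd rE']]]; case: (ndvdX (n := i)).
pose b := e^-1 * f * w ^+ (j - i.+1); have Rb : R b by rewrite /b; in_subring subR.
have wj : w ^+ j = w * w ^+ (j - i.+1) * w ^+ i by rewrite -exprS -exprD; congr (_ ^+ _); lia.
apply: (dvd_in_unit_mull subR (jac b Rb)); exists (e^-1 * (d - c)).
  by in_subring subR.
rewrite [RHS]mulrCA; have -> : u * (d - c) = e * w ^+ i - f * w ^+ j.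
  have -> : u * (d - c) = (f * w ^+ j + u * d) - u * c - f * w ^+ j by ring.
  by rewrite -rE' rE; ring.
by rewrite wj /b; field.
Qed.

End OrderModulo.

Section LocalRingTwoGenerators.
Variables (K : fieldType) (R : K -> Prop) (u w : K).
Hypotheses (noethR : is_noetherian R) (Ru : R u) (Rw : R w).
Hypothesis locR : is_local_with_max R (ideal2 R u w).

Let subR : is_subring R. Proof. by case: noethR. Qed.

Lemma local_jacobson_l : in_jacobson R u.
Proof. exact/(local_jacobson subR locR)/ideal2l. Qed.

Lemma local_jacobson_r : in_jacobson R w.
Proof. exact/(local_jacobson subR locR)/ideal2r. Qed.

Lemma order_mod0_unit r : order_mod R u w r 0 -> unit_in R r.
Proof.
move=> [e [c [Ue Rc ->]]]; rewrite expr0 mulr1; apply: (local_unitD subR locR) => //.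
exact/dvd_in_ideal2l/dvd_in_mulr.
Qed.

Lemma order_mod_approx n r : R r -> ideal2 R u (w ^+ n) r \/ exists j, order_mod R u w r j.
Proof.
move=> Rr; elim: n => [|n [/ideal2P [d [c [Rd Rc rE]]]|]]; last by right.
  by left; apply/ideal2P; exists 0, r; split; rewrite ?expr0; try in_subring subR; ring.
have [/ideal2P [a [b [Ra Rb cE]]]|mc] := EM (ideal2 R u w c); last first.
  by right; exists n, c, d; split=> //; [exact: (local_unit locR) | rewrite rE; ring].
left; apply/ideal2P; exists (d + a * w ^+ n), b; split; try by in_subring subR.
by rewrite rE cE exprS; ring.
Qed.

Lemma uniserial_nilpotent n : dvd_in R u (w ^+ n) -> uniserial_mod R u w.
Proof.
move=> uw r Rr; have [|] := order_mod_approx n Rr; last by right.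
by left; apply: ideal2_least (dvd_in_ideal subR Ru) (dvd_in_refl subR u) uw _.
Qed.

Lemma uniserial_regular :
  (forall c, R c -> dvd_in R u (w * c) -> dvd_in R u c) -> uniserial_mod R u w.
Proof.
move=> regw r Rr; have [|no_order] := EM (exists j, order_mod R u w r j); [by right | left].
have idu := dvd_in_ideal subR Ru.
apply: (krull_intersection subR noethR Rw local_jacobson_r idu regw Rr) => n.
have [/ideal2P [a [b [Ra Rb rE]]]|//] := order_mod_approx n Rr.
by exists b => //; exists a => //; rewrite rE; ring.
Qed.

(** [Q] is principal modulo [u] because [R/uR] is uniserial, and [uR] meets [Q] in [uQ]; so
Nakayama's lemma applies. *)
Lemma uniserial_principal Q : uniserial_mod R u w -> is_ideal R Q ->
    (forall c, R c -> Q (u * c) -> Q c) ->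
  exists2 h, Q h & forall z, Q z -> dvd_in R h z.
Proof.
move=> serR idQ Qu; have fgQ := noetherian_fin_gen subR noethR idQ.
have QR z : Q z -> R z by apply: (ideal_mem idQ).
have divQ z : Q z -> dvd_in R u z -> exists2 d, Q d & z = u * d.
  by move=> Qz [d Rd zE]; exists d => //; apply: Qu; rewrite -?zE.
pose has_order j := `[<exists2 z, Q z & order_mod R u w z j>].
have [exj|noj] := EM (exists j, has_order j); last first.
  exists 0; first exact: (ideal0 idQ).
  have id0 := dvd_in_ideal subR (subring0 subR).
  apply: (nakayama subR Ru local_jacobson_l id0 idQ fgQ) => z Qz.
  have [/(divQ z Qz) [d Qd ->]|[j zj]] := serR z (QR _ Qz).
    by exists d => //; rewrite subrr; apply: dvd_in0.
  by case: noj; exists j; apply/asboolP; exists z.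
have [j /asboolP [h Qh [e [c [Ue Rc hE]]]] minj] := ex_minnP exj; exists h => //.
apply: (nakayama subR Ru local_jacobson_l (dvd_in_ideal subR (QR _ Qh)) idQ fgQ) => z Qz.
have [/(divQ z Qz) [d Qd ->]|[i zi]] := serR z (QR _ Qz).
  by exists d => //; rewrite subrr; apply: dvd_in0.
have le_ji : (j <= i)%N by apply: minj; apply/asboolP; exists z.
have [e' [c' [Ue' Rc' zE]]] := zi; have [[Re e0 Re'] [Rf _ _]] := (Ue, Ue').
pose b := e' * e^-1 * w ^+ (i - j); have Rb : R b by rewrite /b; in_subring subR.
have zbE : z - b * h = u * (c' - b * c).
  by rewrite zE hE /b -{1}(subnK le_ji) exprD; field.
exists (c' - b * c); last by rewrite -zbE subKr mulrC; apply: dvd_in_mulr.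
apply: Qu; first by in_subring subR.
by rewrite -zbE; apply: (idealB subR idQ) => //; apply: (idealZl idQ).
Qed.

End LocalRingTwoGenerators.

Section DimensionTwo.
Variables (K : fieldType) (R P : K -> Prop) (noethR : is_noetherian R).
Hypotheses (primeP : is_prime_ideal R P) (P_neq0 : exists2 z, P z & z != 0).

Let subR : is_subring R. Proof. by case: noethR. Qed.

(** A case of Krull's principal ideal theorem: if [w ^+ n] were in [uR], then [P] would be generated
by one element [h] of [(u, w)], and cancelling [h] in [h ^+ n = u * f] leads to [1 = u * f']. *)
Lemma dim2_parameter_ndvdX u w n : R u -> R w -> is_local_with_max R (ideal2 R u w) ->
  ~ (P u /\ P w) -> ~ dvd_in R u (w ^+ n).
Proof.
move=> Ru Rw locR notPuw uw; have [idP P1 prP] := primeP.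
have serR := uniserial_nilpotent noethR Ru Rw locR uw.
have Pu : ~ P u.
  move=> Pu; apply: notPuw; split=> //; apply: (prime_ideal_exp subR primeP Rw (n := n)).
  by have [c Rc ->] := uw; apply: (idealZr idP).
have divP c : R c -> P (u * c) -> P c by move=> Rc /prP [].
have [h Ph hP] := uniserial_principal noethR Ru Rw locR serR idP divP.
have h0 : h != 0.
  apply/eqP => h0; have [z /hP [c _ ->] /eqP] := P_neq0; apply.
  by rewrite h0 mul0r.
have Rh := ideal_mem idP Ph.
have mh : ideal2 R u w h.
  by apply: contrapT => /(local_unit locR Rh) Uh; apply: P1; apply: (ideal_unit idP Uh).
have : dvd_in R u (h ^+ n).
  exact: ideal2_least (dvd_in_ideal subR Ru) (dvd_in_refl subR u) uw (ideal2_exp subR n Ru Rw mh).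
elim: (n) => [|i IH] [f Rf].
  rewrite expr0 => uf; apply: (local_not1 subR locR).
  by apply: dvd_in_ideal2l => //; exists f.
rewrite exprS => hE; have /hP [g Rg fE] : P f.
  by apply: divP => //; rewrite -hE; apply: (idealZr idP) => //; in_subring subR.
by apply: IH; exists g => //; apply: (mulfI h0); rewrite hE fE mulrCA.
Qed.

Variables u w : K.
Hypotheses (Ru : R u) (Rw : R w) (locR : is_local_with_max R (ideal2 R u w)).
Hypothesis notPuw : ~ (P u /\ P w).

Let ndvdX n : ~ dvd_in R u (w ^+ n). Proof. exact: dim2_parameter_ndvdX. Qed.

Lemma dim2_parameter_regular c : R c -> dvd_in R u (w * c) -> dvd_in R u c.
Proof.
move=> Rc uwc; have idu := dvd_in_ideal subR Ru.
pose J n := colon R (dvd_in R u) (w ^+ n).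
have idJ : is_ideal R (fun z => exists n, J n z).
  apply: (directed_union_ideal 0%N) => [n|i j]; first exact: colon_ideal.
  exists (i + j)%N; split=> z [Rz uz]; split=> //.
    by rewrite addnC exprD -mulrA; apply: dvd_inMl => //; in_subring subR.
  by rewrite exprD -mulrA; apply: dvd_inMl => //; in_subring subR.
apply: (nakayama subR Rw (local_jacobson_r noethR locR) idu idJ).
- exact: noetherian_fin_gen.
- move=> z [n [Rz uz]].
  have [/ideal2P [a [b [Ra Rb zE]]]|mz] := EM (ideal2 R u w z); last first.
    case: (ndvdX (n := n)); apply: (dvd_in_unit_mull subR (local_unit locR Rz mz)).
    by rewrite mulrC.
  exists b; last by exists a => //; rewrite zE; ring.
  exists n.+1; split=> //; have -> : w ^+ n.+1 * b = w ^+ n * z - u * (w ^+ n * a).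
    by rewrite zE exprS; ring.
  by apply: dvd_inB => //; apply: dvd_in_mulr; in_subring subR.
- by exists 1%N; split=> //; rewrite expr1.
Qed.

Lemma dim2_parameter_prime : prime_in R u.
Proof.
split=> // [||a b Ra Rb uab].
- apply/eqP => u0; have : ~ dvd_in R w (u ^+ 1).
    by apply: dim2_parameter_ndvdX; rewrite 1?ideal2C // => -[Pw Pu]; apply: notPuw.
  by rewrite u0 expr1; apply; apply: dvd_in0.
- by have := @ndvdX 0; rewrite expr0.
have serR := uniserial_regular noethR Ru Rw locR dim2_parameter_regular.
have [|[i ai]] := serR a Ra; first by left.
have [|[j bj]] := serR b Rb; first by right.
by case: (order_mod_ndvd subR ndvdX (order_modM subR Ru Rw ai bj)).
Qed.

End DimensionTwo.

(** * Factoriality *)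

Section Factorial.
Variables (K : fieldType) (R : K -> Prop) (subR : is_subring R).

Definition prime_factorization r : Prop := exists e (s : seq K),
  [/\ unit_in R e, (forall p, p \in s -> prime_in R p) & r = e * \prod_(p <- s) p].

Definition is_factorial : Prop := forall r, R r -> r != 0 -> prime_factorization r.

Lemma prime_factorization_unit e : unit_in R e -> prime_factorization e.
Proof. by move=> Ue; exists e, [::]; rewrite big_nil mulr1. Qed.

Lemma prime_factorization_prime p : prime_in R p -> prime_factorization p.
Proof.
move=> pp; exists 1, [:: p]; rewrite big_seq1 mul1r; split=> //; first exact: unit_in1.
by move=> q; rewrite inE => /eqP ->.
Qed.

Lemma prime_factorizationM r s :
  prime_factorization r -> prime_factorization s -> prime_factorization (r * s).
Proof.
move=> [e [ps [Ue pr ->]]] [f [qs [Uf pr' ->]]]; exists (e * f), (ps ++ qs); split.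
- exact: unit_inM.
- by move=> p; rewrite mem_cat => /orP [/pr|/pr'].
- by rewrite big_cat mulrACA.
Qed.

Lemma prime_factorization_prod (s : seq K) :
  (forall p, p \in s -> prime_factorization p) -> prime_factorization (\prod_(p <- s) p).
Proof.
move=> facs; rewrite big_seq; apply: big_ind => //; last exact: prime_factorizationM.
exact/prime_factorization_unit/unit_in1.
Qed.

End Factorial.

Section TwoDimensionalFactorial.
Variables (K : fieldType) (R : K -> Prop) (u w : K).
Hypotheses (noethR : is_noetherian R) (Rw : R w).
Hypothesis locR : is_local_with_max R (ideal2 R u w).
Hypotheses (prime_u : prime_in R u) (nuw : ~ dvd_in R u w).

Let subR : is_subring R. Proof. by case: noethR. Qed.
Let Ru : R u. Proof. by case: prime_u. Qed.
Let u0 : u != 0. Proof. by case: prime_u. Qed.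

Let ndvdX n : ~ dvd_in R u (w ^+ n).
Proof. by move/(prime_in_dvdX subR prime_u Rw). Qed.

Let serR : uniserial_mod R u w.
Proof.
by apply: uniserial_regular => // c Rc; have [_ _ _ pru] := prime_u; move=> /pru [].
Qed.

(** The ideal [(r : a)] is saturated with respect to [u], hence principal. *)
Lemma irreducible_in_prime r : irreducible_in R r -> ~ dvd_in R u r -> prime_in R r.
Proof.
move=> [Rr nUr irr_r] nur; have [_ _ _ pru] := prime_u.
split=> // [||a b Ra Rb rab]; first by apply/eqP => r0; apply: nur; rewrite r0; apply: dvd_in0.
  by move/(dvd_in1_unit Rr).
have idr := colon_ideal subR a (dvd_in_ideal subR Rr).
have [c Rc [_ [d Rd dE]]|h [Rh [c Rc ahE]] hdvd] :=
  uniserial_principal noethR Ru Rw locR serR idr.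
  split=> //; have : dvd_in R u (r * d).
    by rewrite -dE mulrCA; apply: dvd_in_mulr; in_subring subR.
  move=> /pru [] // [f Rf dE'].
  by exists f => //; apply: (mulfI u0); rewrite mulrCA dE dE' mulrCA.
have [|d Rd rE] := hdvd r; first by split=> //; apply: dvd_inMl => //; apply: dvd_in_refl.
have [[_ h0 Rh']|[_ d0 Rd']] := irr_r h d Rh Rd rE.
  by left; exists (c * h^-1); [in_subring subR | rewrite mulrA -ahE mulfK].
right; have [|f Rf ->] := hdvd b; first by split.
by exists (d^-1 * f); [in_subring subR | rewrite rE; field].
Qed.

Lemma prime_factorization_order r j : order_mod R u w r j -> prime_factorization R r.
Proof.
elim/ltn_ind: j r => j IH r rj.
have nur := order_mod_ndvd subR ndvdX rj.
have Rr : R r by have [e [c [[Re _ _] Rc ->]]] := rj; in_subring subR.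
have [Ur|nUr] := EM (unit_in R r); first exact: prime_factorization_unit.
have [irr_r|red_r] := EM (irreducible_in R r).
  exact/prime_factorization_prime/irreducible_in_prime.
have [a [b [Ra Rb rE nUa nUb]]] :
    exists a b, [/\ R a, R b, r = a * b, ~ unit_in R a & ~ unit_in R b].
  apply: contrapT => no; apply: red_r; split=> // a b Ra Rb rE.
  by apply: contrapT => /not_orP [nUa nUb]; apply: no; exists a, b.
have order_gt0 d : R d -> ~ unit_in R d -> dvd_in R d r ->
    exists2 i, order_mod R u w d i & (0 < i)%N.
  move=> Rd nUd dr; have [ud|[[|i] di]] := serR Rd; last by exists i.+1.
    by case: nur; apply: dvd_in_trans dr.
  by case: nUd; apply: order_mod0_unit di.
have [|i ai i_gt0] := order_gt0 a Ra nUa; first by rewrite rE; apply: dvd_in_mulr.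
have [|l bl l_gt0] := order_gt0 b Rb nUb; first by rewrite rE mulrC; apply: dvd_in_mulr.
have jE : j = (i + l)%N.
  apply: (order_mod_uniq subR Rw ndvdX (local_jacobson_r noethR locR) rj).
  by rewrite rE; apply: order_modM.
by rewrite rE; apply: prime_factorizationM => //; [apply: IH ai | apply: IH bl]; lia.
Qed.

Lemma two_dimensional_factorial : is_factorial R.
Proof.
move=> r Rr r0; have jac := local_jacobson_l noethR locR.
have [n [d [Rd nud ->]]] := in_jacobson_multiplicity subR noethR Ru u0 jac Rr r0.
have [//|[j dj]] := serR Rd.
apply: prime_factorizationM (prime_factorization_order dj) => //.
elim: n => [|n IH]; first exact/prime_factorization_unit/unit_in1.
by rewrite exprS; apply: prime_factorizationM => //; apply: prime_factorization_prime.
Qed.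

End TwoDimensionalFactorial.

(** * Simple ring extensions and Hilbert's basis theorem *)

Section PolynomialsOver.
Variable K : fieldType.
Implicit Types (R : K -> Prop) (f g : {poly K}) (c : K).

Definition poly_in R f : Prop := forall i, R f`_i.

Section Closure.
Variables (R : K -> Prop) (subR : is_subring R).

Lemma poly_in0 : poly_in R 0.
Proof. by move=> i; rewrite coef0; in_subring subR. Qed.

Lemma poly_inC c : R c -> poly_in R c%:P.
Proof. by move=> Rc i; rewrite coefC; case: eqP => _ //; in_subring subR. Qed.

Lemma poly_inX : poly_in R 'X.
Proof. by move=> i; rewrite coefX; case: eqP => _; in_subring subR. Qed.

Lemma poly_inD f g : poly_in R f -> poly_in R g -> poly_in R (f + g).
Proof. by move=> Rf Rg i; rewrite coefD; apply: subringD. Qed.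

Lemma poly_inN f : poly_in R f -> poly_in R (- f).
Proof. by move=> Rf i; rewrite coefN; apply: subringN. Qed.

Lemma poly_inM f g : poly_in R f -> poly_in R g -> poly_in R (f * g).
Proof. by move=> Rf Rg i; rewrite coefM; apply: subring_sum => // j _; apply: subringM. Qed.

Lemma poly_inXn n : poly_in R 'X^n.
Proof. by move=> i; rewrite coefXn; case: eqP => _; in_subring subR. Qed.

Lemma poly_in_horner f c : poly_in R f -> R c -> R f.[c].
Proof.
move=> Rf Rc; rewrite horner_coef; apply: subring_sum => // i _.
by have := Rf i; in_subring subR.
Qed.

End Closure.

Lemma poly_in_ind R (Q : {poly K} -> Prop) : Q 0 ->
  (forall f c, poly_in R f -> R c -> Q f -> Q (f * 'X + c%:P)) ->
  forall f, poly_in R f -> Q f.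
Proof.
move=> Q0 QS; elim/poly_ind => [|f c IH] Rf //.
have Rf' : poly_in R f.
  by move=> i; have := Rf i.+1; rewrite coefD coefMX coefC /= addr0.
apply: QS => //; last exact: IH.
by have := Rf 0%N; rewrite coefD coefMX coefC /= add0r.
Qed.

Lemma poly_in_divXsubC R c f : is_subring R -> R c -> poly_in R f ->
  exists2 g, poly_in R g & f = g * ('X - c%:P) + f.[c]%:P.
Proof.
move=> subR Rc; move: f; apply: poly_in_ind => [|f d Rf Rd [g Rg fE]].
  by exists 0; rewrite ?mul0r ?horner0 ?addr0 //; apply: poly_in0.
have Rfc := poly_in_horner subR Rf Rc; exists (g * 'X + f.[c]%:P).
  by apply: poly_inD (poly_inM subR Rg (poly_inX subR)) (poly_inC subR Rfc).
by rewrite {1}fE hornerD hornerMX hornerC polyCD polyCM; ring.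
Qed.

Lemma size_sub_lead f g n :
  (size f <= n.+1)%N -> (size g <= n.+1)%N -> f`_n = g`_n -> (size (f - g)%R <= n)%N.
Proof.
move=> sf sg fg; apply/leq_sizeP => j; rewrite leq_eqVlt => /predU1P [<-|lt_nj].
  by rewrite coefB fg subrr.
by rewrite coefB !nth_default ?subrr //; apply: leq_trans lt_nj.
Qed.

End PolynomialsOver.

Ltac in_poly subR :=
  repeat first [assumption | apply: (poly_in0 subR) | apply: (poly_inX subR)
    | apply: (poly_inXn subR) | apply: (poly_inD subR) | apply: (poly_inN subR)
    | apply: (poly_inM subR) | apply: (poly_inC subR)]; in_subring subR.

Section Adjoin.
Variables (K : fieldType) (R : K -> Prop) (t : K) (subR : is_subring R).
Implicit Types (f g : {poly K}) (T : K -> Prop).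

Lemma adjoin_horner f : poly_in R f -> adjoin R t f.[t].
Proof. by move=> Rf; exists f. Qed.

Lemma adjoin_subring : is_subring (adjoin R t).
Proof.
split; first by exists 0; rewrite horner0; split=> //; apply: poly_in0.
- by exists 1%:P; rewrite hornerC; split=> //; apply: poly_inC => //; in_subring subR.
- move=> _ _ [f [Rf ->]] [g [Rg ->]]; exists (f - g); rewrite !hornerE; split=> //.
  by rewrite -/(poly_in R _); in_poly subR.
- move=> _ _ [f [Rf ->]] [g [Rg ->]]; exists (f * g); rewrite !hornerE; split=> //.
  by rewrite -/(poly_in R _); in_poly subR.
Qed.

Lemma adjoin_base r : R r -> adjoin R t r.
Proof. by move=> Rr; rewrite -(hornerC r t); apply: adjoin_horner; apply: poly_inC. Qed.

Lemma adjoin_gen : adjoin R t t.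
Proof. by rewrite -{2}(hornerX t); apply: adjoin_horner; apply: poly_inX. Qed.

Lemma adjoin_ind T : T 0 ->
  (forall z r, adjoin R t z -> T z -> R r -> T (z * t + r)) ->
  forall z, adjoin R t z -> T z.
Proof.
move=> T0 TS _ [f [Rf ->]]; move: f Rf; apply: poly_in_ind => [|f c Rf Rc IH].
  by rewrite horner0.
by rewrite hornerD hornerMX hornerC; apply: TS => //; apply: adjoin_horner.
Qed.

Lemma adjoin_least T z :
  is_subring T -> (forall r, R r -> T r) -> T t -> adjoin R t z -> T z.
Proof.
move=> subT RT Tt; move: z; apply: adjoin_ind; first by in_subring subT.
by move=> z r _ Tz /RT Tr; in_subring subT.
Qed.

Lemma adjoin_mod_gen a : adjoin R t a -> exists2 r, R r & dvd_in (adjoin R t) t (a - r).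
Proof.
move: a; apply: adjoin_ind => [|z r Az _ Rr].
  by exists 0; rewrite ?subrr; [in_subring subR | apply/dvd_in0/adjoin_subring].
by exists r => //; rewrite addrK mulrC; apply: dvd_in_mulr.
Qed.

End Adjoin.

Lemma adjoin_translate (K : fieldType) (R : K -> Prop) (t c : K) :
  is_subring R -> R c -> adjoin R (t + c) = adjoin R t.
Proof.
move=> subR Rc; apply/predeqP => z.
have subA s := adjoin_subring s subR; have sub_base s r := @adjoin_base K R s subR r.
split; apply: adjoin_least => //; try exact: sub_base.
  by apply: (subringD (subA t)); [apply: adjoin_gen | apply: sub_base].
rewrite -{2}[t](addrK c); apply: (subringB (subA (t + c))); last exact: sub_base.
exact: adjoin_gen.
Qed.

Section HilbertBasis.
Variables (K : fieldType) (R I : K -> Prop) (t : K).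
Hypotheses (noethR : is_noetherian R) (idI : is_ideal (adjoin R t) I).
Implicit Types (f g : {poly K}).

Let subR : is_subring R. Proof. by case: noethR. Qed.
Let subA : is_subring (adjoin R t). Proof. exact: adjoin_subring. Qed.

Let J f : Prop := poly_in R f /\ I f.[t].

Let JD f g : J f -> J g -> J (f + g).
Proof.
by move=> [Rf If] [Rg Ig]; split; [in_poly subR | rewrite hornerD; exact: (idealD idI)].
Qed.

Let JM f g : poly_in R f -> J g -> J (f * g).
Proof.
move=> Rf [Rg Ig]; split; first by in_poly subR.
by rewrite hornerM; apply: (idealZl idI) => //; apply: adjoin_horner.
Qed.

Let JB f g : J f -> J g -> J (f - g).
Proof. by move=> Jf Jg; apply: JD => //; rewrite -mulN1r; apply: JM => //; in_poly subR. Qed.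

Let lead n c : Prop := exists f, [/\ J f, (size f <= n.+1)%N & f`_n = c].

Let ideal_lead n : is_ideal R (lead n).
Proof.
split.
- by move=> _ [f [[Rf _] _ <-]].
- exists 0; split; rewrite ?size_poly0 ?coef0 //.
  by split; [apply: poly_in0 | rewrite horner0; apply: (ideal0 idI)].
- move=> _ _ [f [Jf sf <-]] [g [Jg sg <-]].
  exists (f + g); split; [exact: JD | | by rewrite coefD].
  by apply: leq_trans (size_polyD _ _) _; rewrite geq_max sf sg.
- move=> r _ Rr [f [Jf sf <-]]; exists (r%:P * f); split; last by rewrite coefCM.
    by apply: JM => //; apply: poly_inC.
  by rewrite mul_polyC; apply: leq_trans (size_scale_leq _ _) sf.
Qed.

Let lead_le n m c : (n <= m)%N -> lead n c -> lead m c.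
Proof.
move=> /subnK <-; elim: (m - n)%N => [|d IH] // /IH [f [Jf sf <-]].
exists ('X * f); split; first by apply: JM => //; apply: poly_inX.
  have [->|f0] := eqVneq f 0; first by rewrite mulr0 size_poly0.
  by rewrite mulrC size_mulX.
by rewrite coefXM addSn.
Qed.

Let spanned (P : {poly K} -> Prop) : Prop := exists s : seq K,
  (forall c, List.In c s -> I c) /\ forall f, J f -> P f -> ideal_gen (adjoin R t) s f.[t].

Let spanned_lead n (cs : seq K) : (forall c, List.In c cs -> lead n c) ->
  spanned (fun f => (size f <= n)%N) ->
  spanned (fun f => (size f <= n.+1)%N /\ ideal_gen R cs f`_n).
Proof.
move=> + [s [Is span_s]]; elim: cs => [|c cs IH] lead_cs.
  exists s; split=> // f Jf [sf /ideal_gen_nil fn]; apply: span_s => //.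
  by rewrite -[f]subr0; apply: size_sub_lead; rewrite ?size_poly0 ?coef0.
have [|s' [Is' span_s']] := IH; first by move=> d dcs; apply: lead_cs; right.
have [|g [Jg sg gn]] := lead_cs c; first by left.
exists (g.[t] :: s'); split=> [h [<-|/Is' //]|f Jf [sf]]; first by case: Jg.
move=> /ideal_gen_cons [a Ra fn]; apply/ideal_gen_cons; exists a; first exact: adjoin_base.
have -> : f.[t] - a * g.[t] = (f - a%:P * g).[t] by rewrite !hornerE.
apply: span_s'; first by apply: JB => //; apply: JM => //; apply: poly_inC.
split; last by rewrite coefB coefCM gn.
apply: leq_trans (size_polyD _ _) _; rewrite size_polyN mul_polyC geq_max sf.
exact: leq_trans (size_scale_leq _ _) sg.
Qed.

Let spanned_size n : spanned (fun f => (size f <= n)%N).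
Proof.
elim: n => [|n IH].
  exists [::]; split=> // f _; rewrite size_poly_leq0 => /eqP ->.
  by rewrite horner0; apply/ideal_gen_nil.
have [cs [lead_cs cs_lead]] := noetherian_fin_gen subR noethR (ideal_lead n).
have [s [Is span_s]] := spanned_lead lead_cs IH; exists s; split=> // f Jf sf.
by apply: span_s => //; split=> //; apply: cs_lead; exists f.
Qed.

(** The chain of the ideals [lead n] is stationary from some [n] on, so a polynomial in [J] of
larger degree has the same leading coefficient as a multiple of one of degree [n]. *)
Lemma adjoin_ideal_fin_gen : fin_gen (adjoin R t) I.
Proof.
have dir_lead i j : exists l, (forall z, lead i z -> lead l z) /\ (forall z, lead j z -> lead l z).
  by exists (maxn i j); split=> z; apply: lead_le; rewrite ?leq_maxl ?leq_maxr.
have idL := directed_union_ideal 0%N ideal_lead dir_lead.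
have [n lead_n] :=
  fin_gen_directed_union 0%N ideal_lead dir_lead (noetherian_fin_gen subR noethR idL).
have [s [Is span_s]] := spanned_size n.+1; exists s; split=> // z Iz.
have [f [Rf zE]] := ideal_mem idI Iz; move: Iz; rewrite {z}zE => If.
have [m sf] := ubnPleq (size f); elim: m => [|m IH] in f sf Rf If *.
  move: sf; rewrite size_poly_leq0 => /eqP ->; rewrite horner0; apply: ideal0.
  by apply: ideal_gen_ideal => // g /Is /(ideal_mem idI).
have [sfn|lt_nf] := leqP (size f) n.+1; first exact: span_s.
have le_nm : (n <= m)%N by have := leq_trans lt_nf sf; lia.
have [|g [Jg sg gn]] := lead_n m f`_m; first by exists f.
have Jmg : J ('X^(m - n) * g) by apply: JM => //; apply: poly_inXn.
have idA := ideal_gen_ideal subA (fun h hs => ideal_mem idI (Is h hs)).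
rewrite -(subrK ('X^(m - n) * g) f) hornerD; apply: (idealD idA).
  have [Rfg Ifg] := JB (conj Rf If) Jmg; apply: IH => //.
  apply: size_sub_lead => //; last by rewrite coefXnM ltnNge leq_subr /= subKn.
  apply: leq_trans (size_polyMleq _ _) _; rewrite size_polyXn /=.
  by move: sg le_nm; move: (size g); lia.
rewrite hornerM hornerXn; apply: (idealZl idA); last exact: span_s.
by apply: subringX => //; apply: adjoin_gen.
Qed.

End HilbertBasis.

Lemma adjoin_noetherian (K : fieldType) (R : K -> Prop) t :
  is_noetherian R -> is_noetherian (adjoin R t).
Proof.
move=> noethR; apply: fin_gen_noetherian; first by case: noethR => /(adjoin_subring t).
by move=> I; apply: adjoin_ideal_fin_gen.
Qed.

(** * Rings of fractions *)

Section Fractions.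
Variables (K : fieldType) (R S : K -> Prop) (subR : is_subring R).

Definition multiplicative_set : Prop :=
  [/\ S 1, ~ S 0, (forall s, S s -> R s) & (forall s t, S s -> S t -> S (s * t))].

Definition fractions : K -> Prop := fun z => exists r s, [/\ R r, S s & z = r / s].

Hypothesis multS : multiplicative_set.

Let S1 : S 1. Proof. by case: multS. Qed.
Let SR s : S s -> R s. Proof. by case: multS => _ _ + _; apply. Qed.
Let SM s t : S s -> S t -> S (s * t). Proof. by case: multS => _ _ _; apply. Qed.

Lemma multiplicative_set_neq0 s : S s -> s != 0.
Proof. by case: multS => _ S0 _ _ Ss; apply/eqP => s0; apply: S0; rewrite -s0. Qed.

Lemma fractions_base r : R r -> fractions r.
Proof. by move=> Rr; exists r, 1; rewrite divr1. Qed.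

Lemma fractions_unit s : S s -> unit_in fractions s.
Proof.
move=> Ss; split; [exact/fractions_base/SR | exact: multiplicative_set_neq0 |].
by exists 1, s; rewrite div1r; split=> //; in_subring subR.
Qed.

Lemma fractions_subring : is_subring fractions.
Proof.
split; try by apply: fractions_base; in_subring subR.
- move=> _ _ [r [s [Rr Ss ->]]] [r' [s' [Rr' Ss' ->]]]; have [Rs Rs'] := (SR Ss, SR Ss').
  exists (r * s' - r' * s), (s * s'); split; [by in_subring subR | exact: SM |].
  by field; rewrite !multiplicative_set_neq0.
- move=> _ _ [r [s [Rr Ss ->]]] [r' [s' [Rr' Ss' ->]]].
  exists (r * r'), (s * s'); split; [by in_subring subR | exact: SM |].
  by field; rewrite !multiplicative_set_neq0.
Qed.

Let subL : is_subring fractions. Proof. exact: fractions_subring. Qed.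

Lemma fractions_least (T : K -> Prop) z : is_subring T -> (forall r, R r -> T r) ->
  (forall s, S s -> T s^-1) -> fractions z -> T z.
Proof. by move=> subT RT ST [r [s [/RT Tr /ST Ts ->]]]; in_subring subT. Qed.

Lemma fractions_noetherian : is_noetherian R -> is_noetherian fractions.
Proof.
move=> noethR; apply: fin_gen_noetherian => // J idJ.
have idJR : is_ideal R (fun z => R z /\ J z).
  split=> [z []//||a b [Ra Ja] [Rb Jb]|r a Rr [Ra Ja]]; split; try by in_subring subR.
  - exact: (ideal0 idJ).
  - exact: (idealD idJ).
  - by apply: (idealZl idJ) => //; apply: fractions_base.
have [s [Js sJ]] := noetherian_fin_gen subR noethR idJR.
exists s; split=> [g /Js []//|z Jz]; have [r [d [Rr Sd zE]]] := ideal_mem idJ Jz.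
have idL : is_ideal fractions (ideal_gen fractions s).
  by apply: ideal_gen_ideal => // g /Js [_ /(ideal_mem idJ)].
apply: (ideal_unit_mull idL (fractions_unit Sd)).
have -> : d * z = r by rewrite zE; field; apply: multiplicative_set_neq0.
apply: (ideal_gen_mono fractions_base); apply: sJ; split=> //.
have -> : r = d * z by rewrite zE; field; apply: multiplicative_set_neq0.
by apply: (idealZl idJ) => //; apply/fractions_base/SR.
Qed.

Section Primes.
Variable p : K.
Hypotheses (prime_p : prime_in R p) (pS : forall s, S s -> ~ dvd_in R p s).

Lemma fractions_dvd_in a : R a -> dvd_in fractions p a -> dvd_in R p a.
Proof.
move=> Ra [_ [r [s [Rr Ss ->]]] aE]; have [_ _ _ prp] := prime_p.
have : dvd_in R p (a * s) by exists r => //; rewrite aE; field; apply: multiplicative_set_neq0.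
by move=> /prp [||//|/(pS Ss)] //; apply: SR.
Qed.

Lemma fractions_prime : prime_in fractions p.
Proof.
have [Rp p0 np1 prp] := prime_p; split=> //; first exact: fractions_base.
  by move/fractions_dvd_in => p1; apply/np1/p1; in_subring subR.
have dvd_div r s : S s -> dvd_in R p r -> dvd_in fractions p (r / s).
  by move=> Ss [c Rc ->]; exists (c / s); [exists c, s | rewrite mulrA].
move=> _ _ [r [s [Rr Ss ->]]] [r' [s' [Rr' Ss' ->]]] prr'.
have /fractions_dvd_in : dvd_in fractions p (r * r').
  have -> : r * r' = r / s * (r' / s') * (s * s') by field; rewrite !multiplicative_set_neq0.
  by apply: dvd_inMr => //; apply/fractions_base/SR/SM.
case/(_ _)/prp => //; first by in_subring subR.
  by left; apply: dvd_div.
by right; apply: dvd_div.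
Qed.

End Primes.

Lemma factorial_fractions : is_factorial R -> is_factorial fractions.
Proof.
move=> facR z [r [s [Rr Ss zE]]]; have s0 := multiplicative_set_neq0 Ss; rewrite {}zE => rs0.
have r0 : r != 0 by apply: contraNneq rs0 => ->; rewrite mul0r.
rewrite mulrC; apply: prime_factorizationM => //.
  exact/prime_factorization_unit/unit_inV/fractions_unit.
have [e [ps [[Re e0 Re'] prime_ps ->]]] := facR r Rr r0.
apply: prime_factorizationM => //.
  by apply: prime_factorization_unit; split=> //; apply: fractions_base.
apply: prime_factorization_prod => // p /prime_ps prime_p; have [Rp p0 _ _] := prime_p.
have [[d Sd [c Rc dE]]|pS] := EM (exists2 d, S d & dvd_in R p d); last first.
  apply/prime_factorization_prime/fractions_prime => // d Sd pd.
  by apply: pS; exists d.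
apply: prime_factorization_unit; split=> //; first exact: fractions_base.
have := multiplicative_set_neq0 Sd; rewrite dE mulf_eq0 negb_or => /andP [_ c0].
by exists c, d; split=> //; rewrite dE; field; rewrite p0 c0.
Qed.

End Fractions.

(** * Localization at a prime ideal *)

Section Localization.
Variables (K : fieldType) (R I : K -> Prop).
Hypotheses (subR : is_subring R) (primeI : is_prime_ideal R I).

Let idI : is_ideal R I. Proof. by case: primeI. Qed.
Let I1 : ~ I 1. Proof. by case: primeI. Qed.
Let notIM s s' : R s -> R s' -> ~ I s -> ~ I s' -> ~ I (s * s').
Proof. exact: (prime_ideal_notM primeI). Qed.
Let neq0 s : ~ I s -> s != 0. Proof. exact: (ideal_notin_neq0 idI). Qed.

Lemma localizeE : localize R I = fractions R (fun s => R s /\ ~ I s).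
Proof.
apply/predeqP => z; split=> [[r [s [Rr Rs Is ->]]]|[r [s [Rr [Rs Is] ->]]]];
  by exists r, s.
Qed.

Lemma prime_complement_multiplicative_set : multiplicative_set R (fun s => R s /\ ~ I s).
Proof.
split=> [||s []//|s s' [Rs Is] [Rs' Is']]; first by split=> //; in_subring subR.
  by move=> [_]; apply; apply: (ideal0 idI).
by split; [in_subring subR | apply: notIM].
Qed.

Let multI : multiplicative_set R (fun s => R s /\ ~ I s).
Proof. exact: prime_complement_multiplicative_set. Qed.

Lemma localize_base r : R r -> localize R I r.
Proof. by rewrite localizeE; apply: fractions_base. Qed.

Lemma localize_unit s : R s -> ~ I s -> unit_in (localize R I) s.
Proof. by rewrite localizeE => Rs Is; apply: fractions_unit. Qed.

Lemma localize_subring : is_subring (localize R I).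
Proof. by rewrite localizeE; apply: fractions_subring. Qed.

Let subL : is_subring (localize R I). Proof. exact: localize_subring. Qed.

Lemma localize_noetherian : is_noetherian R -> is_noetherian (localize R I).
Proof. by rewrite localizeE; apply: fractions_noetherian. Qed.

Lemma localize_least (T : K -> Prop) z : is_subring T -> (forall r, R r -> T r) ->
  (forall s, R s -> ~ I s -> T s^-1) -> localize R I z -> T z.
Proof. by move=> subT RT ST; rewrite localizeE; apply: fractions_least => // s []; apply: ST. Qed.

Section Primes.
Variable p : K.
Hypotheses (prime_p : prime_in R p) (Ip : I p).

Let ndvd_p s : R s /\ ~ I s -> ~ dvd_in R p s.
Proof. by move=> [_ Is] [c Rc sE]; apply: Is; rewrite sE; apply: (idealZr idI). Qed.

Lemma localize_dvd_in a : R a -> dvd_in (localize R I) p a -> dvd_in R p a.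
Proof. by rewrite localizeE; apply: fractions_dvd_in. Qed.

Lemma localize_prime : prime_in (localize R I) p.
Proof. by rewrite localizeE; apply: fractions_prime. Qed.

Lemma localize_localize_dvd_in z :
  localize (localize R I) (dvd_in (localize R I) p) z -> localize R (dvd_in R p) z.
Proof.
have prime_dvd := dvd_in_prime_ideal subR prime_p.
case=> _ [_ [[r [s [Rr Rs Is ->]]] [r' [s' [Rr' Rs' Is' ->]]] pr' ->]].
exists (r * s'), (s * r'); split; try by in_subring subR.
  apply: (prime_ideal_notM prime_dvd) => // [|[c Rc r'E]]; first exact: (ndvd_p (conj Rs Is)).
  by apply: pr'; exists (c / s'); [exists c, s' | rewrite r'E mulrA].
by rewrite !invfM invrK; ring.
Qed.

End Primes.

Definition localized_ideal (J : K -> Prop) : K -> Prop :=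
  fun z => exists a s, [/\ J a, R s, ~ I s & z = a / s].

Lemma localized_ideal_ideal J : is_ideal R J -> is_ideal (localize R I) (localized_ideal J).
Proof.
move=> idJ; split.
- by move=> _ [a [s [/(ideal_mem idJ) Ra Rs Is ->]]]; exists a, s.
- by exists 0, 1; rewrite mul0r; split=> //; [apply: (ideal0 idJ) | in_subring subR].
- move=> _ _ [a [s [Ja Rs Is ->]]] [a' [s' [Ja' Rs' Is' ->]]].
  exists (s' * a + s * a'), (s * s'); split; [|by in_subring subR|exact: notIM|].
    by apply: (idealD idJ); apply: (idealZl idJ).
  by field; rewrite !neq0.
- move=> _ _ [r [s [Rr Rs Is ->]]] [a [s' [Ja Rs' Is' ->]]].
  exists (r * a), (s * s'); split; [exact: (idealZl idJ)|by in_subring subR|exact: notIM|].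
  by field; rewrite !neq0.
Qed.

Lemma localize_local : is_local_with_max (localize R I) (localized_ideal I).
Proof.
apply: local_with_max_intro; first exact: localized_ideal_ideal.
  move=> [a [s [Ia Rs Is /esym/divr1_eq sE]]].
  by apply: Is; rewrite -sE.
move=> _ [r [s [Rr Rs Is ->]]] Irs; have Ir : ~ I r by move=> Ir; apply: Irs; exists r, s.
by apply: unit_inM => //; [|apply: unit_inV]; apply: localize_unit.
Qed.

Lemma localized_ideal2 p q : R p -> R q ->
  localized_ideal (ideal2 R p q) = ideal2 (localize R I) p q.
Proof.
move=> Rp Rq; apply/predeqP => z; split.
  move=> [_ [s [/ideal2P [a [b [Ra Rb ->]]] Rs Is ->]]]; apply/ideal2P.
  by exists (a / s), (b / s); split; [exists a, s | exists b, s | ring].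
have idE := localized_ideal_ideal (ideal2_ideal subR Rp Rq).
have base v : ideal2 R p q v -> localized_ideal (ideal2 R p q) v.
  by move=> mv; exists v, 1; rewrite divr1; split=> //; in_subring subR.
by apply: ideal2_least => //; apply: base; [apply: ideal2l | apply: ideal2r].
Qed.

Lemma localize_coefficient_field (k : K -> Prop) :
  coefficient_field R I k -> coefficient_field (localize R I) (localized_ideal I) k.
Proof.
move=> [fieldk kR resk kI]; split=> // [c /kR|_ [r [s [Rr Rs Is ->]]]|c kc [a [s [Ia Rs Is cE]]]].
- exact: localize_base.
- have [[c [kc Irc]] [d [kd Isd]]] := (resk r Rr, resk s Rs).
  have [subk invk] := fieldk.
  have Id : ~ I d by move=> Id; apply: Is; rewrite -(subrK d s); apply: (idealD idI).
  have d0 := neq0 Id; exists (c / d); split; first by have := invk d kd d0; in_subring subk.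
  exists (d * (r - c) - c * (s - d)), (s * d).
  have [Rc Rd] := (kR c kc, kR d kd); split; [|by in_subring subR|exact: notIM|].
    by apply: (idealB subR idI); apply: (idealZl idI).
  by field; rewrite d0 neq0.
- have [_ _ prI] := primeI; have : I (c * s) by rewrite cE divfK ?neq0.
  by move=> /prI [||/kI ->|] //; apply: kR.
Qed.

End Localization.

Lemma localize_localize (K : fieldType) (R P Q : K -> Prop) :
    is_subring R -> is_prime_ideal R P -> is_prime_ideal R Q -> (forall v, P v -> Q v) ->
  localize R P = fractions (localize R Q) (fun s => R s /\ ~ P s).
Proof.
move=> subR primeP primeQ PQ; apply/predeqP => z; split.
  by move=> [r [s [Rr Rs Ps ->]]]; exists r, s; split=> //; apply: localize_base.
move=> [_ [s [[b [c [Rb Rc Qc ->]]] [Rs Ps] ->]]]; exists b, (c * s).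
split; [by []|by in_subring subR| |by rewrite invfM mulrA].
by apply: (prime_ideal_notM primeP) => // /PQ.
Qed.

Lemma coefficient_field_prime_ideal (K : fieldType) (R I k : K -> Prop) :
  is_subring R -> is_ideal R I -> coefficient_field R I k -> is_prime_ideal R I.
Proof.
move=> subR idI [[subk _] kR resk kI]; split=> // [I1|a b Ra Rb Iab].
  have /eqP := kI 1 (subring1 subk) I1; by rewrite oner_eq0.
have [[c [kc Iac]] [d [kd Ibd]]] := (resk a Ra, resk b Rb); have [Rc Rd] := (kR c kc, kR d kd).
have /eqP : c * d = 0.
  apply: kI; first by in_subring subk.
  have -> : c * d = a * b - (b * (a - c) + c * (b - d)) by ring.
  by apply: (idealB subR idI) => //; apply: (idealD idI); apply: (idealZl idI).
rewrite mulf_eq0 => /orP [] /eqP E; [left | right].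
  by rewrite E subr0 in Iac.
by rewrite E subr0 in Ibd.
Qed.

(** * Quadratic transforms *)

Section QuadraticTransform.
Variables (K : fieldType) (R : K -> Prop) (p q : K).
Hypotheses (subR : is_subring R) (prime_p : prime_in R p) (prime_q : prime_in R q).
Hypothesis npq : ~ dvd_in R p q.

Let t := q / p.
Let A := adjoin R t.
Let M := ideal2 A p t.

Let Rp : R p. Proof. by case: prime_p. Qed.
Let Rq : R q. Proof. by case: prime_q. Qed.
Let p0 : p != 0. Proof. by case: prime_p. Qed.
Let q0 : q != 0. Proof. by case: prime_q. Qed.
Let qE : q = p * t. Proof. by rewrite /t mulrC divfK. Qed.
Let subA : is_subring A. Proof. exact: adjoin_subring. Qed.
Let RA r : R r -> A r. Proof. exact: adjoin_base. Qed.
Let At : A t. Proof. exact: adjoin_gen. Qed.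
Let idm : is_ideal R (ideal2 R p q). Proof. exact: ideal2_ideal. Qed.

Lemma prime_pair_ndvd : ~ dvd_in R q p.
Proof.
move=> /(prime_in_dvd_prime subR prime_q prime_p) [e [Re e0 Re'] pE].
by apply: npq; exists e^-1 => //; rewrite pE mulfK.
Qed.

Let clear_denominators f n : poly_in R f -> (size f <= n.+1)%N -> R (p ^+ n * f.[t]).
Proof.
move=> Rf sf; rewrite horner_coef mulr_sumr; apply: subring_sum => //= i _.
have le_in : (i <= n)%N by rewrite -ltnS; apply: leq_trans sf.
have -> : p ^+ n * (f`_i * t ^+ i) = f`_i * (p ^+ (n - i) * q ^+ i).
  by rewrite qE [(p * t) ^+ _]exprMn -{1}(subnK le_in) exprD; ring.
by have := Rf i; in_subring subR.
Qed.

(** Clearing denominators shows that [p] divides [f`_n.+1 * q ^+ n.+1]. *)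
Let lead_coef_dvd f n : poly_in R f -> (size f <= n.+2)%N -> f.[t] = 0 -> dvd_in R p f`_n.+1.
Proof.
move=> Rf sf f0; pose g := f - (f`_n.+1)%:P * 'X^(n.+1).
have Rfn := Rf n.+1; have Rg : poly_in R g by rewrite /g; in_poly subR.
have sg : (size g <= n.+1)%N.
  apply: size_sub_lead => //; last by rewrite coefCM coefXn eqxx mulr1.
  by rewrite mul_polyC; apply: leq_trans (size_scale_leq _ _) _; rewrite size_polyXn.
have : dvd_in R p (f`_n.+1 * q ^+ n.+1).
  exists (- (p ^+ n * g.[t])); first by apply: subringN => //; apply: clear_denominators.
  by rewrite /g !hornerE f0 qE exprMn exprS; ring.
by have [_ _ _ prp] := prime_p => /prp [||//|/(prime_in_dvdX subR prime_p Rq)] //; in_subring subR.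
Qed.

(** A leading coefficient divisible by [p] can be traded for a term of lower degree, as
[p * t = q]. *)
Lemma adjoin_kernel f : poly_in R f -> f.[t] = 0 -> poly_in (ideal2 R p q) f.
Proof.
have [n sf] := ubnPleq (size f); elim: n => [|[|n] IH] in f sf *.
- by move: sf; rewrite size_poly_leq0 => /eqP -> _ _ i; rewrite coef0; apply: (ideal0 idm).
- have fE := size1_polyC sf; rewrite fE hornerC => _ f0 i.
  by rewrite f0 coefC; case: ifP => _; apply: (ideal0 idm).
move=> Rf f0; have [e Re fn] := lead_coef_dvd Rf sf f0.
pose g := f - (p * e)%:P * 'X^(n.+1) + (e * q)%:P * 'X^n.
have mg : poly_in (ideal2 R p q) g.
  apply: IH; last by rewrite /g !hornerE f0 qE exprS; ring.
    apply: leq_trans (size_polyD _ _) _; rewrite geq_max; apply/andP; split.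
      apply: size_sub_lead => //; last by rewrite coefCM coefXn eqxx mulr1.
      by rewrite mul_polyC; apply: leq_trans (size_scale_leq _ _) _; rewrite size_polyXn.
    by rewrite mul_polyC; apply: leq_trans (size_scale_leq _ _) _; rewrite size_polyXn.
  by rewrite /g; in_poly subR.
move=> i; have -> : f`_i = g`_i + (e * ('X^(n.+1))`_i) * p - (e * ('X^n)`_i) * q.
  by rewrite /g !(coefD, coefN, coefCM); ring.
have RX m := poly_inXn subR m i.
apply: (idealB subR idm); first apply: (idealD idm) => //.
  by apply: (idealZl idm); [have := RX n.+1; in_subring subR | apply: ideal2l].
by apply: (idealZl idm); [have := RX n; in_subring subR | apply: ideal2r].
Qed.

Lemma adjoin_dvd_gen a : R a -> dvd_in A t a -> dvd_in R q a.
Proof.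
move=> Ra [_ [f [Rf ->]] aE].
have : dvd_in R q (p ^+ (size f).+1 * a).
  exists (p ^+ (size f) * f.[t]); first exact: clear_denominators.
  by rewrite aE qE exprS; ring.
have [_ _ _ prq] := prime_q => /prq [||qp|//] //; first by in_subring subR.
by case: prime_pair_ndvd; apply: prime_in_dvdX qp.
Qed.

Lemma prime_adjoin_gen : prime_in A t.
Proof.
have [_ _ nq1 prq] := prime_q; split=> //.
- by rewrite mulf_neq0 ?invr_eq0.
- by move/adjoin_dvd_gen => t1; apply/nq1/t1; in_subring subR.
move=> a b Aa Ab tab.
have [[r Rr tr] [s Rs ts]] := (adjoin_mod_gen subR Aa, adjoin_mod_gen subR Ab).
have [rA sA] := (RA Rr, RA Rs).
have : dvd_in R q (r * s).
  apply: adjoin_dvd_gen; first by in_subring subR.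
  have -> : r * s = a * b - ((a - r) * b + (b - s) * r) by ring.
  by apply: dvd_inB => //; apply: dvd_inD => //; apply: dvd_inMr.
have lift c d : dvd_in A t (c - d) -> dvd_in R q d -> dvd_in A t c.
  move=> tcd [e Re dE]; rewrite -(subrK d c); apply: dvd_inD => //.
  by exists (p * e); [have := RA Re; have := RA Rp; in_subring subA | rewrite dE qE; ring].
by move=> /prq [||qr|qs] //; [left; apply: lift tr qr | right; apply: lift ts qs].
Qed.

(** As [R[q/p] / (q/p) = R / (q)], the transform lies between [R] and its localization at [(q)]. *)
Lemma transform_sub_localize z : localize A M z -> localize R (dvd_in R q) z.
Proof.
set W := localize R (dvd_in R q); have prime_dvd := dvd_in_prime_ideal subR prime_q.
have subW : is_subring W by apply: localize_subring.
have RW r : R r -> W r by apply: localize_base.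
have unitW r : R r -> ~ dvd_in R q r -> unit_in W r by apply: localize_unit.
have tW : dvd_in W q t.
  by exists p^-1; have [] := unitW p Rp prime_pair_ndvd.
have AW a : A a -> W a.
  by apply: adjoin_least => //; have [c Wc ->] := tW; have := RW q Rq; in_subring subW.
have locW : is_local_with_max W (dvd_in W q).
  apply: local_with_max_intro; first exact/dvd_in_ideal/RW.
    have [_ _ nq1 _] := prime_q; move=> /(localize_dvd_in subR prime_dvd prime_q).
    by move=> h; apply: nq1; apply: h; [apply: dvd_in_refl | in_subring subR].
  move=> _ [r [s [Rr Rs qs ->]]] qrs; apply: unit_inM => //; last exact/unit_inV/unitW.
  by apply: unitW => // -[c Rc rE]; apply: qrs; exists (c / s); [exists c, s | rewrite rE mulrA].
apply: localize_least => // s As Ms.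
suff [] : unit_in W s by [].
have [r Rr [a Aa sE]] := adjoin_mod_gen subR As; rewrite -(subrK r s) addrC.
apply: (local_unitD subW locW); last by rewrite sE; apply: dvd_inMr => //; apply: AW.
apply: unitW => // -[c Rc rE]; apply: Ms; apply: dvd_in_ideal2r => //.
exists (a + p * c); first by have := RA Rp; have := RA Rc; in_subring subA.
by rewrite -(subrK r s) sE rE qE; ring.
Qed.

Variable k : K -> Prop.
Hypothesis cfk : coefficient_field R (ideal2 R p q) k.

Let fieldk : is_subfield k. Proof. by case: cfk. Qed.
Let subk : is_subring k. Proof. by case: fieldk. Qed.
Let kR c : k c -> R c. Proof. by case: cfk => _ + _ _; apply. Qed.

Lemma adjoin_residue a : A a -> exists2 F, poly_in k F & dvd_in A p (a - F.[t]).
Proof.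
move: a; apply: adjoin_ind => [|z r Az [F kF [d Ad dE]] Rr].
  by exists 0; rewrite ?horner0 ?subrr; [apply: poly_in0 | apply: dvd_in0].
have [_ _ resk _] := cfk; have [c [kc /ideal2P [a [b [Ra Rb cE]]]]] := resk r Rr.
exists (F * 'X + c%:P); first by in_poly subk.
exists (d * t + a + b * t); first by have := RA Ra; have := RA Rb; in_subring subA.
have -> : z * t + r - (F * 'X + c%:P).[t] = (z - F.[t]) * t + (r - c).
  by rewrite hornerD hornerMX hornerC; ring.
by rewrite dE cE qE; ring.
Qed.

Lemma adjoin_residue_eq0 F : poly_in k F -> dvd_in A p F.[t] -> F = 0.
Proof.
move=> kF [_ [g [Rg ->]] FE]; apply/polyP => i; rewrite coef0.
have [_ _ _ km] := cfk; apply: km => //.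
have RF : poly_in R F by move=> j; apply: kR.
have -> : F`_i = (F - p%:P * g)`_i + p * g`_i by rewrite coefB coefCM subrK.
apply: (idealD idm); last by apply: (idealZr idm) => //; apply: ideal2l.
by apply: adjoin_kernel; [in_poly subR | rewrite !hornerE FE subrr].
Qed.

Lemma prime_adjoin_denominator : prime_in A p.
Proof.
split=> //; first exact: RA.
  move=> p1; have /eqP : (1%:P : {poly K}) = 0.
    by apply: adjoin_residue_eq0; [apply: poly_inC => //; in_subring subk | rewrite hornerC].
  by rewrite polyC_eq0 oner_eq0.
move=> a b Aa Ab pab.
have [[F kF pF] [G kG pG]] := (adjoin_residue Aa, adjoin_residue Ab).
have Ak H : poly_in k H -> A H.[t] by move=> kH; apply: adjoin_horner => i; apply: kR.
have /eqP : F * G = 0.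
  apply: adjoin_residue_eq0; first by in_poly subk.
  have -> : (F * G).[t] = a * b - ((a - F.[t]) * b + (b - G.[t]) * F.[t]).
    by rewrite hornerM; ring.
  by apply: dvd_inB => //; apply: dvd_inD => //; apply: dvd_inMr => //; apply: Ak.
rewrite mulf_eq0 => /orP [] /eqP FG0; [left | right].
  by rewrite FG0 horner0 subr0 in pF.
by rewrite FG0 horner0 subr0 in pG.
Qed.

Lemma adjoin_denominator_ndvd_gen : ~ dvd_in A p t.
Proof.
rewrite -(hornerX t) => /adjoin_residue_eq0 X0; have /eqP : ('X : {poly K}) = 0.
  by apply: X0; apply: poly_inX.
by rewrite polyX_eq0.
Qed.

Lemma adjoin_coefficient_field : coefficient_field A M k.
Proof.
split=> // [c /kR/RA //|a Aa|c kc /ideal2P [a [b [Aa Ab cE]]]].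
  have [r Rr [d Ad dE]] := adjoin_mod_gen subR Aa; have [_ _ resk _] := cfk.
  have [c [kc /ideal2P [b [b' [Rb Rb' cE]]]]] := resk r Rr; exists c; split=> //.
  apply/ideal2P; exists (b + b' * t), d.
  split; [by have := RA Rb; have := RA Rb'; in_subring subA | by [] |].
  by rewrite -(subrK r a) dE -addrA cE qE; ring.
have [F kF [d Ad dE]] := adjoin_residue Ab.
have /(congr1 (fun f : {poly K} => f`_0)) : c%:P - F * 'X = 0.
  apply: adjoin_residue_eq0; first by in_poly subk.
  exists (a + d * t); first by in_subring subA.
  have -> : (c%:P - F * 'X).[t] = a * p + (b - F.[t]) * t.
    by rewrite hornerD hornerN hornerMX hornerC {1}cE; ring.
  by rewrite dE; ring.
by rewrite coefB coefMX coefC coef0 subr0.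
Qed.

Lemma transform_center_prime : is_prime_ideal A M.
Proof.
apply: (coefficient_field_prime_ideal subA _ adjoin_coefficient_field).
by apply: ideal2_ideal => //; apply: RA.
Qed.

End QuadraticTransform.

(** By Krull's height theorem [R] then has dimension two, with the chain of primes [0], [(p)] and
[(p, q)]. *)
Definition regular_parameters (K : fieldType) (R : K -> Prop) (p q : K) : Prop :=
  [/\ is_noetherian R, is_local_with_max R (ideal2 R p q), prime_in R p, prime_in R q &
      ~ dvd_in R p q].

Lemma regular_parametersC (K : fieldType) (R : K -> Prop) (p q : K) :
  regular_parameters R p q -> regular_parameters R q p.
Proof.
move=> [noethR locR pp pq npq]; have [subR _] := noethR.
by split=> //; [rewrite ideal2C | apply: prime_pair_ndvd npq].
Qed.

Section RegularTransform.
Variables (K : fieldType) (R k : K -> Prop) (p q : K).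
Hypotheses (regR : regular_parameters R p q) (cfk : coefficient_field R (ideal2 R p q) k).

Let A := adjoin R (q / p).
Let M := ideal2 A p (q / p).

Let noethR : is_noetherian R. Proof. by case: regR. Qed.
Let subR : is_subring R. Proof. by case: noethR. Qed.
Let subA : is_subring A. Proof. exact: adjoin_subring. Qed.
Let prime_p : prime_in R p. Proof. by case: regR. Qed.
Let prime_q : prime_in R q. Proof. by case: regR. Qed.
Let npq : ~ dvd_in R p q. Proof. by case: regR. Qed.
Let primeM : is_prime_ideal A M. Proof. exact: transform_center_prime cfk. Qed.
Let Ap : A p. Proof. by have [Rp _ _ _] := prime_p; apply: adjoin_base. Qed.
Let At : A (q / p). Proof. exact: adjoin_gen. Qed.

Let extM : localized_ideal A M M = ideal2 (localize A M) p (q / p).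
Proof. exact: localized_ideal2. Qed.

Lemma regular_parameters_transform : regular_parameters (localize A M) p (q / p).
Proof.
have prime_Ap : prime_in A p := prime_adjoin_denominator subR prime_p prime_q npq cfk.
have Mp : M p by apply: ideal2l.
split.
- exact/localize_noetherian/adjoin_noetherian.
- by rewrite -extM; apply: localize_local.
- exact: localize_prime.
- by apply: localize_prime => //; [apply: prime_adjoin_gen | apply: ideal2r].
move/(localize_dvd_in subA primeM prime_Ap Mp At).
exact: (adjoin_denominator_ndvd_gen subR prime_p prime_q npq cfk).
Qed.

Lemma coefficient_field_transform :
  coefficient_field (localize A M) (ideal2 (localize A M) p (q / p)) k.
Proof.
rewrite -extM; apply: localize_coefficient_field => //.
exact: adjoin_coefficient_field.
Qed.

End RegularTransform.

(** * Factorial rings are Krull domains *)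

Section PrimeValuation.
Variables (K : fieldType) (R : K -> Prop) (subR : is_subring R).
Implicit Types (p q z : K) (m n : int).

Definition has_valuation p z n : Prop := exists a b,
  [/\ R a, R b, ~ dvd_in R p a, ~ dvd_in R p b & z = p ^ n * (a / b)].

(** The junk value outside of [frac R] and at [0] is [0]. *)
Definition prime_valuation p z : int := xget 0 (has_valuation p z).

Let ndvd_neq0 p b : ~ dvd_in R p b -> b != 0.
Proof. by move=> pb; apply/eqP => b0; apply: pb; rewrite b0; apply: dvd_in0. Qed.

Section Prime.
Variable p : K.
Hypothesis prime_p : prime_in R p.

Let p0 : p != 0. Proof. by case: prime_p. Qed.
Let Rp : R p. Proof. by case: prime_p. Qed.
Let np1 : ~ dvd_in R p 1. Proof. by case: prime_p. Qed.
Let ndvdM a b : R a -> R b -> ~ dvd_in R p a -> ~ dvd_in R p b -> ~ dvd_in R p (a * b).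
Proof. exact: (prime_in_ndvdM prime_p). Qed.

Lemma has_valuation_ge z n m a b : has_valuation p z n -> R a -> R b -> ~ dvd_in R p b ->
  z = p ^ m * (a / b) -> m <= n.
Proof.
move=> [c [d [Rc Rd pc pd zE]]] Ra Rb pb zE'; rewrite leNgt; apply/negP => lt_nm.
apply: (ndvdM Rc Rb pc pb); have [l mE] : exists l : nat, m = n + l.+1%:Z.
  by exists (absz (m - n - 1)%R); lia.
exists (p ^+ l * (a * d)); first by in_subring subR.
have [d0 b0] := (ndvd_neq0 pd, ndvd_neq0 pb).
have /(mulfI (expfz_neq0 n p0)) cdE : p ^ n * (c / d) = p ^ n * (p ^+ l.+1 * (a / b)).
  by rewrite -zE zE' mE expfzDr // -exprnP; ring.
have -> : c * b = (c / d) * (d * b) by field.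
by rewrite cdE exprS; field.
Qed.

Lemma has_valuation_uniq z n m : has_valuation p z n -> has_valuation p z m -> n = m.
Proof.
move=> vn vm; apply/le_anti/andP; split.
  by have [a [b [Ra Rb pa pb zE]]] := vn; apply: has_valuation_ge vm Ra Rb pb zE.
by have [a [b [Ra Rb pa pb zE]]] := vm; apply: has_valuation_ge vn Ra Rb pb zE.
Qed.

Lemma has_valuationM z z' n m :
  has_valuation p z n -> has_valuation p z' m -> has_valuation p (z * z') (n + m).
Proof.
move=> [a [b [Ra Rb pa pb ->]]] [a' [b' [Ra' Rb' pa' pb' ->]]].
exists (a * a'), (b * b'); split; try by [in_subring subR | apply: ndvdM].
by rewrite expfzDr // invfM; ring.
Qed.

Lemma has_valuationD_ge z z' n m l : has_valuation p z n -> has_valuation p z' m ->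
  has_valuation p (z + z') l -> Num.min n m <= l.
Proof.
move=> [a [b [Ra Rb pa pb zE]]] [a' [b' [Ra' Rb' pa' pb' zE']]] vl.
have split_min (i : int) : Num.min n m <= i -> exists d, p ^ i = p ^ Num.min n m * p ^+ d.
  move=> le_i; exists (absz (i - Num.min n m)%R).
  by rewrite exprnP -expfzDr //; congr (p ^ _); lia.
have [d nE] : exists d, p ^ n = p ^ Num.min n m * p ^+ d by apply: split_min; rewrite ge_min lexx.
have [d' mE] : exists d, p ^ m = p ^ Num.min n m * p ^+ d.
  by apply: split_min; rewrite ge_min lexx orbT.
have [b0 b0'] := (ndvd_neq0 pb, ndvd_neq0 pb').
apply: (@has_valuation_ge (z + z') _ _ (p ^+ d * a * b' + p ^+ d' * a' * b) (b * b') vl).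
- by in_subring subR.
- by in_subring subR.
- exact: ndvdM.
by rewrite zE zE' nE mE; field; rewrite b0 b0'.
Qed.

Lemma has_valuation_self : has_valuation p p 1.
Proof. by exists 1, 1; split=> //; try in_subring subR; rewrite divr1 mulr1 expr1z. Qed.

Lemma prime_valuationE z n : has_valuation p z n -> prime_valuation p z = n.
Proof. by move=> vn; apply: (@has_valuation_uniq z) => //; apply: xgetPex; exists n. Qed.

Lemma prime_dvd_prod (s : seq K) : (forall q, q \in s -> R q) ->
  dvd_in R p (\prod_(q <- s) q) -> exists2 q, q \in s & dvd_in R p q.
Proof.
elim: s => [|q s IH] Rs; first by rewrite big_nil.
have Rs' r : r \in s -> R r by move=> rs; apply: Rs; rewrite inE rs orbT.
have Rq := Rs q (mem_head _ _).
have Rprod : R (\prod_(r <- s) r) by rewrite big_seq; apply: subring_prod.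
rewrite big_cons; have [_ _ _ prp] := prime_p; move=> /prp [||pq|/(IH Rs') [r rs pr]] //.
  by exists q; rewrite ?mem_head.
by exists r; rewrite // inE rs orbT.
Qed.

Hypothesis facR : is_factorial R.

Lemma multiplicity_ex r : R r -> r != 0 ->
  exists (n : nat) r', [/\ R r', ~ dvd_in R p r' & r = p ^+ n * r'].
Proof.
move=> Rr r0; have [e [s [Ue prime_s ->]]] := facR Rr r0; have [Re _ _] := Ue.
elim: s prime_s => [|q s IH] prime_s.
  exists 0%N, e; rewrite big_nil expr0 mulr1 mul1r; split=> // pe.
  by apply/np1/(dvd_in_unit_mull subR Ue); rewrite mulr1.
have [|n [r' [Rr' pr' rE]]] := IH; first by move=> h hs; apply: prime_s; rewrite inE hs orbT.
have prime_q := prime_s q (mem_head _ _); have [Rq _ _ _] := prime_q.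
rewrite big_cons mulrCA rE.
have [/(prime_in_dvd_prime subR prime_p prime_q) [d Ud ->]|pq] := EM (dvd_in R p q); last first.
  by exists n, (q * r'); split; [in_subring subR | exact: ndvdM | ring].
have [Rd _ _] := Ud; exists n.+1, (d * r'); split; first by in_subring subR.
  by move=> /(dvd_in_unit_mull subR Ud).
by rewrite exprS; ring.
Qed.

Lemma prime_valuationP z : Defs.frac R z -> z != 0 -> has_valuation p z (prime_valuation p z).
Proof.
move=> [a [b [Ra Rb b0 ->]]]; rewrite mulf_eq0 negb_or => /andP [a0 _]; apply: xgetPex.
have [n [a' [Ra' pa' ->]]] := multiplicity_ex Ra a0.
have [m [b' [Rb' pb' ->]]] := multiplicity_ex Rb b0.
exists (n%:Z - m%:Z), a', b'; split=> //.
by rewrite expfzDr // -exprnN -exprnP invfM; ring.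
Qed.

Lemma prime_valuation_dval : is_dval (Defs.frac R) (prime_valuation p).
Proof.
have R1 := subring1 subR; split.
- move=> a b [a1 [a2 [Ra1 Ra2 a20 aE]]] [b1 [b2 [Rb1 Rb2 b20 bE]]] a0 b0.
  apply/prime_valuationE/has_valuationM; apply: prime_valuationP => //.
    by exists a1, a2.
  by exists b1, b2.
- move=> a b [a1 [a2 [Ra1 Ra2 a20 aE]]] [b1 [b2 [Rb1 Rb2 b20 bE]]] a0 b0 ab0.
  apply: (@has_valuationD_ge a b); apply: prime_valuationP => //.
  + by exists a1, a2.
  + by exists b1, b2.
  exists (a1 * b2 + b1 * a2), (a2 * b2); split; try by in_subring subR.
    by rewrite mulf_neq0.
  by rewrite aE bE; field; rewrite a20 b20.
- exists p; split=> //; first by exists p, 1; rewrite divr1 oner_neq0.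
  exact/prime_valuationE/has_valuation_self.
Qed.

End Prime.
End PrimeValuation.

Section FactorialKrull.
Variables (K : fieldType) (R : K -> Prop).
Hypotheses (subR : is_subring R) (facR : is_factorial R).
Implicit Types (p q z : K).

Definition associated p q : Prop := exists2 e, unit_in R e & q = p * e.

Definition associate_repr p : K := choose (fun q => `[<associated p q>]) p.

Definition canonical_prime p : bool := `[<prime_in R p>] && (associate_repr p == p).

Lemma associated_sym p q : associated p q -> associated q p.
Proof.
by move=> [e [Re e0 Re'] ->]; exists e^-1; [apply: unit_inV | rewrite mulfK].
Qed.

Lemma associated_trans q p r : associated p q -> associated q r -> associated p r.
Proof. by move=> [e Ue ->] [d Ud ->]; exists (e * d); [apply: unit_inM | rewrite mulrA]. Qed.

Lemma associated_refl p : associated p p.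
Proof. by exists 1; [apply: unit_in1 | rewrite mulr1]. Qed.

Lemma associate_reprP p : associated p (associate_repr p).
Proof.
by apply/asboolP; apply: (@chooseP _ (fun q => `[<associated p q>])); apply/asboolP/associated_refl.
Qed.

Lemma eq_associate_repr p q : associated p q -> associate_repr p = associate_repr q.
Proof.
move=> pq; rewrite /associate_repr.
have /eq_choose -> : (fun r => `[<associated p r>]) =1 (fun r => `[<associated q r>]).
  move=> r; apply/asbool_equiv_eq; split; apply: associated_trans => //.
  exact: associated_sym.
by apply: choose_id; apply/asboolP; [apply: associated_sym | apply: associated_refl].
Qed.

Lemma prime_associated p q : prime_in R p -> associated p q -> prime_in R q.
Proof.
move=> [Rp p0 np1 prp] [e [Re e0 Re'] ->].
have dvdE b : dvd_in R (p * e) b <-> dvd_in R p b.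
  split=> -[c Rc ->]; first by exists (e * c); [in_subring subR | rewrite mulrA].
  by exists (e^-1 * c); [in_subring subR | field].
split; [by in_subring subR | by rewrite mulf_neq0 | by rewrite dvdE |].
by move=> a b Ra Rb; rewrite !dvdE; apply: prp.
Qed.

Lemma canonical_prime_repr p : prime_in R p -> canonical_prime (associate_repr p).
Proof.
move=> prime_p; have pp := associate_reprP p; apply/andP; split.
  exact/asboolP/(prime_associated prime_p).
by rewrite -(eq_associate_repr pp).
Qed.

Lemma canonical_primeW p : canonical_prime p -> prime_in R p.
Proof. by move=> /andP [/asboolP]. Qed.

Lemma canonical_prime_dvd p q :
  canonical_prime p -> canonical_prime q -> dvd_in R p q -> p = q.
Proof.
move=> /andP [/asboolP prime_p /eqP <-] /andP [/asboolP prime_q /eqP <-] pq.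
have prime_p' := prime_associated prime_p (associate_reprP p).
have prime_q' := prime_associated prime_q (associate_reprP q).
have [e Ue qE] := prime_in_dvd_prime subR prime_p' prime_q' pq.
apply: eq_associate_repr; apply: associated_trans (associate_reprP p) _.
by apply: associated_trans (associated_sym (associate_reprP q)); exists e.
Qed.

Lemma canonical_factorization r : R r -> r != 0 ->
  exists e s, [/\ unit_in R e, (forall p, p \in s -> canonical_prime p) & r = e * \prod_(p <- s) p].
Proof.
move=> Rr r0; have [e [s [Ue prime_s ->]]] := facR Rr r0.
elim: s prime_s => [|q s IH] prime_s; first by exists e, [::]; rewrite big_nil.
have [|f [s' [Uf can_s' rE]]] := IH; first by move=> p ps; apply: prime_s; rewrite inE ps orbT.
have [d Ud qE] := associated_sym (associate_reprP q).
exists (d * f), (associate_repr q :: s'); split; first exact: unit_inM.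
  move=> p; rewrite inE => /predU1P [->|/can_s' //].
  exact/canonical_prime_repr/prime_s/mem_head.
by rewrite !big_cons mulrCA rE {1}qE; ring.
Qed.

Lemma valuations_ge0_mem z : Defs.frac R z ->
  (forall p, canonical_prime p -> z = 0 \/ 0 <= prime_valuation R p z) -> R z.
Proof.
move=> fracz vz; have [a [b [Ra Rb b0 zE]]] := fracz.
have [e [s [[Re e0 Re'] can_s bE]]] := canonical_factorization Rb b0.
have {zE bE} : z = (a / e) / \prod_(p <- s) p by rewrite zE bE invfM; ring.
have {Ra} : R (a / e) by in_subring subR.
elim: s (a / e) can_s => [|p s IH] {}a can_s Ra zE; first by rewrite zE big_nil divr1.
have can_s' q : q \in s -> canonical_prime q by move=> qs; apply: can_s; rewrite inE qs orbT.
have can_p := can_s p (mem_head _ _).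
have prime_p := canonical_primeW can_p; have [_ p0 _ prp] := prime_p.
rewrite big_cons in zE.
have s0 : \prod_(q <- s) q != 0.
  by rewrite prodf_seq_neq0; apply/allP => q /can_s' /canonical_primeW [].
have [[c Rc aE]|npa] := EM (dvd_in R p a).
  by apply: (IH c) => //; rewrite zE aE; field; rewrite s0 p0.
have z0 : z != 0.
  rewrite zE mulf_neq0 ?invr_eq0 ?mulf_neq0 //.
  by apply/eqP => a0; apply: npa; rewrite a0; apply: dvd_in0.
have := prime_valuationP subR prime_p facR fracz z0.
have [/eqP|] := vz p can_p; first by rewrite (negPf z0).
case: (prime_valuation R p z) => // n _ [c [d [Rc Rd pc pd]]]; rewrite -exprnP => zE'.
case: (prime_in_ndvdM prime_p Ra Rd npa pd).
have Rs : R (\prod_(q <- s) q).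
  by rewrite big_seq; apply: subring_prod => // q /can_s' /canonical_primeW [].
exists (p ^+ n * c * \prod_(q <- s) q); first by have [Rp _ _ _] := prime_p; in_subring subR.
have d0 : d != 0 by apply/eqP => d0; apply: pd; rewrite d0; apply: dvd_in0.
have -> : a * d = z * (p * \prod_(q <- s) q) * d by rewrite zE; field; rewrite s0 p0.
by rewrite zE'; field.
Qed.

Lemma mem_In (T : eqType) (x : T) (s : seq T) : x \in s -> List.In x s.
Proof. by elim: s => //= y s IH; rewrite inE => /predU1P [->|/IH]; [left | right]. Qed.

Lemma factorial_krull : is_krull R.
Proof.
split=> //; exists {p | canonical_prime p}, (fun i => prime_valuation R (sval i)).
have R1 := subring1 subR; split.
- by move=> [p can_p] /=; apply: prime_valuation_dval => //; apply: canonical_primeW.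
- move=> z; split=> [Rz|[fracz vz]]; last first.
    by apply: valuations_ge0_mem => // p can_p; apply: (vz (exist _ p can_p)).
  have fracz : Defs.frac R z by exists z, 1; rewrite divr1 oner_neq0.
  split=> // -[p /= /canonical_primeW prime_p]; have [->|z0] := eqVneq z 0; [by left | right].
  apply: (has_valuation_ge subR prime_p (prime_valuationP subR prime_p facR fracz z0) Rz R1).
    by case: prime_p.
  by rewrite divr1 expr0z mul1r.
move=> z fracz z0; have [a [b [Ra Rb b0 zE]]] := fracz.
have a0 : a != 0 by apply: contraNneq z0 => a0; rewrite zE a0 mul0r.
have [e [s [Ue can_s aE]]] := canonical_factorization Ra a0.
have [f [s' [Uf can_s' bE]]] := canonical_factorization Rb b0.
exists (pmap insub (s ++ s')) => -[p can_p] /= vp; apply: mem_In.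
have prime_p := canonical_primeW can_p; rewrite mem_pmap_sub /= mem_cat.
have dvd_mem c g ps : unit_in R g -> (forall q, q \in ps -> canonical_prime q) ->
    c = g * \prod_(q <- ps) q -> dvd_in R p c -> p \in ps.
  move=> Ug can_ps -> /(dvd_in_unit_mull subR Ug) /(prime_dvd_prod subR prime_p) [q|q qps pq].
    by move=> /can_ps /canonical_primeW [].
  by rewrite (canonical_prime_dvd can_p (can_ps q qps) pq).
apply: contraNT vp; rewrite negb_or => /andP [nps nps']; apply/eqP/prime_valuationE => //.
exists a, b; split; rewrite ?expr0z ?mul1r //.
  by move=> /(dvd_mem a e s Ue can_s aE) ps; rewrite ps in nps.
by move=> /(dvd_mem b f s' Uf can_s' bE) ps; rewrite ps in nps'.
Qed.

End FactorialKrull.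

(** * Polynomials over an algebraically closed subfield *)

Section AlgebraicallyClosedSubfield.
Variables (K : fieldType) (k : K -> Prop).
Hypotheses (fieldk : is_subfield k) (closedk : alg_closed_sub k).

Let subk : is_subring k. Proof. by case: fieldk. Qed.
Let invk c : k c -> c != 0 -> k c^-1. Proof. by case: fieldk => _; apply. Qed.

Lemma alg_closed_infinite (s : seq K) : exists2 b, k b & b \notin s.
Proof.
pose ks := [seq c <- s | `[<k c>]]; pose f := \prod_(c <- 0 :: ks) ('X - c%:P) : {poly K}.
have k0 := subring0 subk.
have kf : poly_in k f.
  rewrite /f big_seq; apply: big_ind => [|g h|c].
  - by apply: poly_inC => //; in_subring subk.
  - exact: poly_inM.
  - rewrite inE mem_filter => /predU1P [->|/andP [/asboolP kc _]]; in_poly subk.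
have [||b [kb /rootP]] := closedk (p := f + 1%:P).
- by rewrite -/(poly_in k _); in_poly subk.
- by rewrite size_polyDl size_prod_XsubC // size_polyC oner_neq0.
rewrite hornerD hornerC => fb; exists b => //; apply/negP => bs.
have /rootP fb0 : root f b by rewrite root_prod_XsubC inE mem_filter bs asboolT ?orbT.
by move/eqP: fb; rewrite fb0 add0r oner_eq0.
Qed.

Lemma poly_ideal_common_root (J : {poly K} -> Prop) :
  (forall f, J f -> poly_in k f) -> (forall f g, J f -> J g -> J (f + g)) ->
  (forall f g, poly_in k f -> J g -> J (f * g)) -> ~ J 1 ->
  exists2 c, k c & forall f, J f -> f.[c] = 0.
Proof.
move=> Jk JD JM J1; have [[f Jf f0]|J0] := EM (exists2 f, J f & f != 0); last first.
  exists 0; first exact: subring0.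
  by move=> f Jf; rewrite (_ : f = 0) ?horner0 //; apply: contra_notP J0 => /eqP; exists f.
have [n sf] := ubnPleq (size f); elim: n => [|n IH] in f Jf f0 sf *.
  by move: sf; rewrite size_poly_leq0 (negPf f0).
have kf := Jk f Jf; have [f1|f1] := leqP (size f) 1.
  have fE := size1_polyC f1; have c0 : f`_0 != 0 by rewrite fE polyC_eq0 in f0.
  case: J1; have -> : 1 = (f`_0)^-1%:P * f by rewrite {2}fE -polyCM mulVf.
  by apply: JM => //; apply: poly_inC => //; apply: invk.
have [c [kc /rootP fc]] := closedk kf f1.
have [//|[g Jg gc]] : (forall g, J g -> g.[c] = 0) \/ exists2 g, J g & g.[c] != 0.
- have [|no] := EM (exists2 g, J g & g.[c] != 0); [by right | left=> g Jg].
  by apply/eqP; apply: contra_notT no => gc; exists g.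
- by exists c.
have kg := Jk g Jg; have [f' kf' fE] := poly_in_divXsubC subk kc kf.
have [g' kg' gE] := poly_in_divXsubC subk kc kg; rewrite fc addr0 in fE.
have f'0 : f' != 0 by apply: contraNneq f0 => f'0; rewrite fE f'0 mul0r.
have kgc := poly_in_horner subk kg kc.
apply: (IH f') => //; last by move: sf; rewrite fE size_Mmonic ?monicXsubC // size_XsubC addn2.
have -> : f' = g.[c]^-1%:P * (f' * g + - g' * f).
  have -> : f' * g + - g' * f = g.[c]%:P * f' by rewrite {1}gE fE; ring.
  by rewrite mulrA -polyCM mulVf ?mul1r.
apply: (JM); first by apply: poly_inC => //; apply: invk.
by apply: JD; apply: (JM) => //; apply: poly_inN.
Qed.

End AlgebraicallyClosedSubfield.

(** * Centers of local overrings *)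

Section Center.
Variables (K : fieldType) (B T m : K -> Prop).
Hypotheses (subB : is_subring B) (subT : is_subring T) (BT : forall z, B z -> T z).
Hypothesis locT : is_local_with_max T m.

Definition center : K -> Prop := fun z => B z /\ m z.

Let idm : is_ideal T m. Proof. exact: local_ideal locT. Qed.

Let notin_center_unit z : B z -> ~ center z -> unit_in T z.
Proof. by move=> Bz cz; apply: (local_unit locT (BT Bz)) => mz; apply: cz. Qed.

Lemma center_prime : is_prime_ideal B center.
Proof.
split=> [|[_ /(local_not1 subT locT)]//|b c Bb Bc [_ mbc]].
  split=> [z []//||a b [Ba ma] [Bb mb]|r a Br [Ba ma]]; split; try by in_subring subB.
  - exact: (ideal0 idm).
  - exact: (idealD idm).
  - by apply: (idealZl idm) => //; apply: BT.
apply: contrapT => /not_orP [nb nc].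
by apply: (local_not_unit locT mbc); apply: unit_inM => //; apply: notin_center_unit.
Qed.

Lemma localize_center_sub z : localize B center z -> T z.
Proof.
apply: (localize_least subT BT) => s Bs cs.
by have [] := notin_center_unit Bs cs.
Qed.

Lemma localize_centerV z : localize B center z -> unit_in T z -> localize B center z^-1.
Proof.
move=> [b [c [Bb Bc cc zE]]] Uz; exists c, b; split=> // [[_ mb]|]; last first.
  by rewrite zE invfM invrK mulrC.
have Uc := notin_center_unit Bc cc; have [_ c0 _] := Uc.
apply: (local_not_unit locT mb); have -> : b = z * c by rewrite zE divfK.
exact: unit_inM.
Qed.

End Center.

(** * The intersection of the rings [beta_a] *)

Lemma regular_local_dim2_parameters (K : fieldType) (D : K -> Prop) (x y : K) :
  regular_local_dim2 D x y -> regular_parameters D x y.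
Proof.
move=> [noethD _ [Dx Dy] locD [[P0 [P1 [P2 [lt01 lt12]]]] _]]; have [subD _] := noethD.
have [[idP0 _ _] primeP1 _ [z [P1z P0z]]] := lt01.
have P1_neq0 : exists2 z, P1 z & z != 0 by exists z; last exact: ideal_notin_neq0 idP0 P0z.
have notP1xy : ~ (P1 x /\ P1 y).
  move=> [P1x P1y]; have [_ [idP2 P21 _] _ [v [P2v P1v]]] := lt12; apply: P1v.
  have [idP1 _ _] := primeP1; apply: (ideal2_least idP1 P1x P1y).
  apply: contrapT => /(local_unit locD (ideal_mem idP2 P2v)) Uv.
  exact: (P21 (ideal_unit idP2 Uv P2v)).
have locD' : is_local_with_max D (ideal2 D y x) by rewrite ideal2C.
split=> //.
- exact: (dim2_parameter_prime noethD primeP1 P1_neq0 Dx Dy locD notP1xy).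
- by apply: (dim2_parameter_prime noethD primeP1 P1_neq0 Dy Dx locD') => -[P1y P1x]; apply: notP1xy.
- by rewrite -[y]expr1; apply: (dim2_parameter_ndvdX noethD primeP1 P1_neq0 Dx Dy locD).
Qed.

Section Intersection.
Variables (K : fieldType) (D k : K -> Prop) (x y : K).
Hypotheses (regD : regular_local_dim2 D x y) (cfk : coefficient_field D (ideal2 D x y) k).
Hypothesis closedk : alg_closed_sub k.

Let fieldk : is_subfield k. Proof. by case: cfk. Qed.
Let subk : is_subring k. Proof. by case: fieldk. Qed.
Let invk c : k c -> c != 0 -> k c^-1. Proof. by case: fieldk => _; apply. Qed.
Let kD c : k c -> D c. Proof. by case: cfk => _ + _ _; apply. Qed.
Let subD : is_subring D. Proof. by case: regD => [[]]. Qed.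
Let Dx : D x. Proof. by case: regD => _ _ []. Qed.
Let Dy : D y. Proof. by case: regD => _ _ []. Qed.

Let t := x / y.
Let u a := (x + a * y) / y.
Let w a := y ^+ 2 / (x + a * y).
Let alpha_ a := alpha D x y a.
Let beta_ a := beta D x y a.
Let m a := ideal2 (beta_ a) (u a) (w a).

Let ideal2_base a : k a -> ideal2 D y (x + a * y) = ideal2 D x y.
Proof. by move=> /kD Da; rewrite ideal2_translate // ideal2C. Qed.

Lemma regular_parameters_base a : k a -> regular_parameters D y (x + a * y).
Proof.
move=> ka; have Da := kD ka; apply: regular_local_dim2_parameters.
by case: regD => noethD fracD _ locD dimD; split; rewrite ?ideal2_base //; split; in_subring subD.
Qed.

Let coefficient_field_base a : k a -> coefficient_field D (ideal2 D y (x + a * y)) k.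
Proof. by move=> ka; rewrite ideal2_base. Qed.

Lemma regular_parameters_alpha a : k a -> regular_parameters (alpha_ a) y (u a).
Proof.
move=> ka; apply: regular_parameters_transform (coefficient_field_base ka).
exact: regular_parameters_base.
Qed.

Let coefficient_field_alpha a : k a -> coefficient_field (alpha_ a) (ideal2 (alpha_ a) y (u a)) k.
Proof.
move=> ka; apply: coefficient_field_transform (coefficient_field_base ka).
exact: regular_parameters_base.
Qed.

Let y0 : y != 0. Proof. by have [_ _ []] := regular_parameters_base (subring0 subk). Qed.

Let u0 a : k a -> u a != 0.
Proof. by move=> /regular_parameters_alpha [_ _ _ []]. Qed.

Let uE a : u a = t + a.
Proof. by rewrite /u /t; field. Qed.

Let wE a : k a -> w a = y / u a.
Proof.
move=> /u0; rewrite /w /u mulf_eq0 negb_or => /andP [xy0 _].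
by rewrite expr2; field; rewrite xy0 y0.
Qed.

Lemma regular_parameters_beta a : k a -> regular_parameters (beta_ a) (u a) (w a).
Proof.
move=> ka; have cf := coefficient_field_alpha ka; rewrite ideal2C in cf.
have := regular_parameters_transform (regular_parametersC (regular_parameters_alpha ka)) cf.
by rewrite -wE.
Qed.

Let coefficient_field_beta a : k a -> coefficient_field (beta_ a) (m a) k.
Proof.
move=> ka; have cf := coefficient_field_alpha ka; rewrite ideal2C in cf.
have := coefficient_field_transform (regular_parametersC (regular_parameters_alpha ka)) cf.
by rewrite -wE.
Qed.

Let loc_beta a : k a -> is_local_with_max (beta_ a) (m a).
Proof. by case/regular_parameters_beta. Qed.
Let sub_alpha a : k a -> is_subring (alpha_ a).
Proof. by case/regular_parameters_alpha => [[]]. Qed.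
Let sub_beta a : k a -> is_subring (beta_ a).
Proof. by case/regular_parameters_beta => [[]]. Qed.
Let idm a : k a -> is_ideal (beta_ a) (m a).
Proof. by move/loc_beta/local_ideal. Qed.
Let m_u a : k a -> m a (u a). Proof. by move/sub_beta => subb; apply: ideal2l. Qed.

Let A := adjoin D t.
Let subA : is_subring A. Proof. exact: adjoin_subring. Qed.

Let adjoin_u a : k a -> adjoin D (u a) = A.
Proof. by move=> /kD Da; rewrite uE adjoin_translate. Qed.

Let alphaE a : k a -> alpha_ a = localize A (ideal2 A y (u a)).
Proof. by move=> ka; rewrite -(adjoin_u ka). Qed.

Let prime_alpha_center a : k a -> is_prime_ideal A (ideal2 A y (u a)).
Proof.
move=> ka; have [[subD' _] _ prime_y prime_q ndvd] := regular_parameters_base ka.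
rewrite -(adjoin_u ka).
exact: (transform_center_prime subD' prime_y prime_q ndvd (coefficient_field_base ka)).
Qed.

Let prime_beta_center a : k a ->
  is_prime_ideal (adjoin (alpha_ a) (w a)) (ideal2 (adjoin (alpha_ a) (w a)) (u a) (w a)).
Proof.
move=> ka.
have [[subal _] _ prime_u prime_y ndvd] :=
  regular_parametersC (regular_parameters_alpha ka).
have cf := coefficient_field_alpha ka; rewrite ideal2C in cf.
by rewrite wE //; apply: (transform_center_prime subal prime_u prime_y ndvd cf).
Qed.

Let A_alpha a z : k a -> A z -> alpha_ a z.
Proof.
by move=> ka Az; rewrite alphaE //; apply: localize_base => //; apply: prime_alpha_center.
Qed.

Let adjoin_beta a z : k a -> adjoin (alpha_ a) (w a) z -> beta_ a z.
Proof.
by move=> ka; apply: localize_base; [apply/adjoin_subring/sub_alpha | apply: prime_beta_center].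
Qed.

Let A_beta a z : k a -> A z -> beta_ a z.
Proof.
move=> ka Az; apply: adjoin_beta => //.
by apply: adjoin_base; [apply: sub_alpha | apply: A_alpha].
Qed.

Let A_u a : k a -> A (u a).
Proof. by move=> ka; rewrite -(adjoin_u ka); apply: adjoin_gen. Qed.

Let A_k c : k c -> A c.
Proof. by move=> /kD; apply: adjoin_base. Qed.

Let A_y : A y. Proof. exact: adjoin_base. Qed.

Let A_horner F : poly_in k F -> A F.[t].
Proof. by move=> kF; apply: adjoin_horner => i; apply: kD. Qed.

(** The valuation ring of the order valuation of [D]; its residue field is [k(t)]. *)
Let V := localize A (dvd_in A y).

Let prime_Ay : prime_in A y.
Proof.
have [_ _ prime_y prime_x ndvd] := regular_parametersC (regular_local_dim2_parameters regD).
by apply: (prime_adjoin_denominator subD prime_y prime_x ndvd (k := k)); rewrite ideal2C.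
Qed.

Let prime_dvdy : is_prime_ideal A (dvd_in A y). Proof. exact: dvd_in_prime_ideal. Qed.
Let sub_V : is_subring V. Proof. exact: localize_subring. Qed.
Let A_V z : A z -> V z. Proof. exact: localize_base. Qed.

Let prime_Vy : prime_in V y.
Proof. by apply: localize_prime => //; apply: dvd_in_refl. Qed.

Lemma order_valuation_ndvd_param a : k a -> ~ dvd_in V y (u a).
Proof.
move=> ka /(localize_dvd_in subA prime_dvdy prime_Ay (dvd_in_refl subA y) (A_u ka)).
have [_ _ prime_y prime_q ndvd] := regular_parameters_base ka; rewrite -(adjoin_u ka).
exact: (adjoin_denominator_ndvd_gen subD prime_y prime_q ndvd (coefficient_field_base ka)).
Qed.

Lemma beta_sub_order_valuation a z : k a -> beta_ a z -> V z.
Proof.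
move=> ka bz.
have [[subal _] _ prime_u prime_y ndvd] :=
  regular_parametersC (regular_parameters_alpha ka).
have : localize (alpha_ a) (dvd_in (alpha_ a) y) z.
  by apply: (transform_sub_localize subal prime_u prime_y ndvd); rewrite -wE.
rewrite alphaE //; apply: localize_localize_dvd_in => //; first exact: prime_alpha_center.
exact: ideal2l.
Qed.

Lemma beta_max_of_dvd_y a z : k a -> beta_ a z -> dvd_in V y z -> m a z.
Proof.
move=> ka bz yz; apply: contrapT => /(local_unit (loc_beta ka) bz) [_ z0 bz'].
have [_ _ ny1 _] := prime_Vy; apply: ny1; rewrite -(mulfV z0).
by apply: dvd_inMr => //; apply: beta_sub_order_valuation bz'.
Qed.

Lemma beta_max_horner a F : k a -> poly_in k F -> m a F.[t] <-> F.[- a] = 0.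
Proof.
move=> ka kF; have kna : k (- a) by in_subring subk.
have [G kG FE] := poly_in_divXsubC subk kna kF; have idma := idm ka.
have mGu : m a (G.[t] * u a).
  by apply: (idealZl idma); [apply/A_beta/A_horner | apply: m_u].
have -> : F.[t] = G.[t] * u a + F.[- a].
  by rewrite {1}FE hornerD hornerM hornerXsubC hornerC opprK uE.
split=> [mF|->]; last by rewrite addr0.
have [_ _ _ km] := coefficient_field_beta ka; apply: km; first exact: (poly_in_horner subk).
by rewrite -(addKr (G.[t] * u a) F.[- a]) addrC; apply: (idealB (sub_beta ka) idma).
Qed.

Let B z := forall a, k a -> beta_ a z.

Let sub_B : is_subring B.
Proof.
split=> [a /sub_beta/subring0 //|a /sub_beta/subring1 //|b c Bb Bc a ka|b c Bb Bc a ka].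
  by apply: (subringB (sub_beta ka)); [apply: Bb | apply: Bc].
by apply: (subringM (sub_beta ka)); [apply: Bb | apply: Bc].
Qed.

Let A_B z : A z -> B z.
Proof. by move=> Az a ka; apply: A_beta. Qed.

Lemma beta_unit_param a b : k a -> k b -> a != b -> unit_in (beta_ a) (u b).
Proof.
move=> ka kb ab; have kba : k (b - a) by apply: subringB.
have ba0 : b - a != 0 by rewrite subr_eq0 eq_sym.
have -> : u b = (b - a) + u a by rewrite !uE; ring.
apply: (local_unitD (sub_beta ka) (loc_beta ka)); last exact: m_u.
by split=> //; apply/A_beta/A_k => //; apply: invk.
Qed.

Lemma beta_notin_param_inv a : k a -> ~ beta_ a (u a)^-1.
Proof.
move=> ka bu'; apply: (local_not_unit (loc_beta ka) (m_u ka)).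
by split=> //; [apply/A_beta/A_u | apply: u0].
Qed.

Let B_w a : k a -> B (w a).
Proof.
move=> ka b kb; have [<-|ba] := eqVneq b a; first exact/adjoin_beta/adjoin_gen/sub_alpha.
rewrite wE //; apply: (subringM (sub_beta kb)); first exact: A_beta.
by have [] := beta_unit_param kb ka ba.
Qed.

Lemma order_valuation_residue z : V z -> exists F G,
  [/\ poly_in k F, poly_in k G, G != 0 & dvd_in V y (G.[t] * z - F.[t])].
Proof.
move=> Vz; have [r [s [Ar As nys zE]]] := Vz.
have [_ _ prime_y prime_x ndvd] := regular_parametersC (regular_local_dim2_parameters regD).
have residue v : A v -> exists2 F, poly_in k F & dvd_in V y (v - F.[t]).
  move=> /(adjoin_residue subD prime_y (k := k)) [|F kF [c Ac vF]]; first by rewrite ideal2C.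
  by exists F => //; exists c => //; apply: A_V.
have [[F kF rF] [G kG sG]] := (residue r Ar, residue s As); exists F, G; split=> //.
  apply/eqP => G0; apply: nys; rewrite G0 horner0 subr0 in sG.
  exact: (localize_dvd_in subA prime_dvdy prime_Ay (dvd_in_refl subA y) As sG).
have s0 : s != 0 by apply/eqP => s0; apply: nys; rewrite s0; apply: dvd_in0.
have -> : G.[t] * z - F.[t] = (r - F.[t]) - (s - G.[t]) * z by rewrite zE; field.
by apply: dvd_inB => //; apply: dvd_inMr.
Qed.

Lemma beta_residue_no_pole a z F G : k a -> beta_ a z -> poly_in k F -> poly_in k G ->
  dvd_in V y (G.[t] * z - F.[t]) -> G.[- a] = 0 -> F.[- a] = 0.
Proof.
move=> ka bz kF kG yGF /(beta_max_horner ka kG) mG; apply/(beta_max_horner ka kF).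
have [idma subb] := (idm ka, sub_beta ka).
have bF : beta_ a F.[t] by apply/A_beta/A_horner.
have mGz : m a (G.[t] * z) by apply: (idealZr idma).
rewrite -(subKr (G.[t] * z) F.[t]); apply: (idealB subb idma) => //; apply: beta_max_of_dvd_y => //.
by apply: (subringB subb) => //; apply: (ideal_mem idma).
Qed.

Lemma intersection_residue z : B z -> exists2 F, poly_in k F & dvd_in V y (z - F.[t]).
Proof.
move=> Bz; have k0 := subring0 subk.
have Vz : V z by apply: (beta_sub_order_valuation k0); apply: Bz.
have [F [G [kF kG G0 yGF]]] := order_valuation_residue Vz.
have [n sG] := ubnPleq (size G); elim: n => [|n IH] in F G kF kG G0 yGF sG *.
  by move: sG; rewrite size_poly_leq0 (negPf G0).
have [G1|G1] := leqP (size G) 1.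
  have GE := size1_polyC G1; have g0 : G`_0 != 0 by rewrite GE polyC_eq0 in G0.
  have kg := invk (kG 0%N) g0; exists ((G`_0)^-1%:P * F); first by in_poly subk.
  rewrite GE hornerC in yGF; rewrite hornerM hornerC.
  have -> : z - (G`_0)^-1 * F.[t] = (G`_0)^-1 * (G`_0 * z - F.[t]) by field.
  by apply: dvd_inMl => //; apply/A_V/A_k.
have [c [kc /rootP Gc]] := closedk kG G1; have knc : k (- c) by in_subring subk.
have Fc : F.[c] = 0.
  by have := beta_residue_no_pole knc (Bz _ knc) kF kG yGF; rewrite opprK; apply.
have [F' kF' FE] := poly_in_divXsubC subk kc kF.
have [G' kG' GE] := poly_in_divXsubC subk kc kG.
rewrite Fc addr0 in FE; rewrite Gc addr0 in GE.
have G'0 : G' != 0 by apply: contraNneq G0 => G'0; rewrite GE G'0 mul0r.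
apply: (IH F' G') => //; last first.
  by move: sG; rewrite GE size_Mmonic ?monicXsubC // size_XsubC addn2.
have VH H : poly_in k H -> V H.[t] by move=> /A_horner/A_V.
have [_ _ _ pry] := prime_Vy.
have : dvd_in V y (u (- c) * (G'.[t] * z - F'.[t])).
  have -> : u (- c) * (G'.[t] * z - F'.[t]) = G.[t] * z - F.[t] => //.
  by rewrite GE FE !hornerM hornerXsubC uE; ring.
move=> /pry [||/(order_valuation_ndvd_param knc)|] //; first exact/A_V/A_u.
by apply: (subringB sub_V); [apply: (subringM sub_V) => // |]; apply: VH.
Qed.

Let M a := center B (m a).

Let prime_M a : k a -> is_prime_ideal B (M a).
Proof.
move=> ka; have B_beta z : B z -> beta_ a z by apply.
exact: (center_prime sub_B (sub_beta ka) B_beta (loc_beta ka)).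
Qed.

(** The residues of the elements of [P] form an ideal of [k[t]], proper because an element of [B]
with residue [1] is a unit. *)
Lemma prime_sub_center P : is_prime_ideal B P ->
  exists2 a, k a & forall z, P z -> M a z.
Proof.
move=> [idP P1 _]; have PB z : P z -> B z by apply: (ideal_mem idP).
pose J F := poly_in k F /\ exists2 z, P z & dvd_in V y (z - F.[t]).
have [F [] //|F G [kF [z Pz zF]] [kG [v Pv vG]]|F G kF [kG [z Pz zG]]|[_ [z Pz z1]]|c kc Jc] :=
  poly_ideal_common_root fieldk closedk (J := J).
- split; first by in_poly subk.
  exists (z + v); first exact: (idealD idP).
  by rewrite hornerD opprD addrACA; apply: dvd_inD.
- split; first by in_poly subk.
  exists (F.[t] * z); first by apply: (idealZl idP) => //; apply/A_B/A_horner.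
  by rewrite hornerM -mulrBr; apply: dvd_inMl => //; apply/A_V/A_horner.
- apply: P1; have unit_z a : k a -> unit_in (beta_ a) z.
    move=> ka; have subb := sub_beta ka; rewrite -(subrK 1 z) addrC.
    apply: (local_unitD subb (loc_beta ka)); first exact: unit_in1.
    apply: beta_max_of_dvd_y => //; last by rewrite hornerC in z1.
    by apply: (subringB subb); [apply: (PB z Pz) | apply: subring1].
  apply: (ideal_unit idP _ Pz); split; first exact: PB.
    by have [] := unit_z 0 (subring0 subk).
  by move=> a /unit_z [].
have knc : k (- c) by in_subring subk.
exists (- c) => // z Pz; split; first exact: PB.
have Bz := PB z Pz; have [F kF zF] := intersection_residue Bz.
rewrite -(subrK F.[t] z); apply: (idealD (idm knc)).
  apply: beta_max_of_dvd_y => //; apply: (subringB (sub_beta knc)); first exact: Bz.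
  exact/A_beta/A_horner.
by apply/beta_max_horner => //; rewrite opprK; apply: Jc; split=> //; exists z.
Qed.

Lemma beta_localization a : k a -> beta_ a = localize B (M a).
Proof.
move=> ka; have subb := sub_beta ka; have locb := loc_beta ka.
have B_beta z : B z -> beta_ a z by apply.
have subL := localize_subring sub_B (prime_M ka).
have B_L z : B z -> localize B (M a) z by apply: localize_base => //; apply: prime_M.
have L_V z : localize B (M a) z -> unit_in (beta_ a) z -> localize B (M a) z^-1.
  exact: (localize_centerV subb B_beta locb).
have al_L z : alpha_ a z -> localize B (M a) z.
  rewrite alphaE //; apply: localize_least => // [r /A_B/B_L //|s As Is].
  apply: L_V; first exact/B_L/A_B.
  have [_ s0 als'] := localize_unit subA (prime_alpha_center ka) As Is.
  split=> //; first exact: A_beta.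
  by apply/adjoin_beta/adjoin_base => //; [apply: sub_alpha | rewrite alphaE].
apply/predeqP => z; split; last exact: (localize_center_sub subb B_beta locb).
have adj_L v : adjoin (alpha_ a) (w a) v -> localize B (M a) v.
  by apply: adjoin_least => //; apply/B_L/B_w.
apply: localize_least => // s As Is; apply: L_V; first exact: adj_L.
have subAw := adjoin_subring (w a) (sub_alpha ka).
exact: (localize_unit subAw (prime_beta_center ka) As Is).
Qed.

Lemma intersection_almost_krull : almost_krull B.
Proof.
split=> // P primeP; have [a ka PM] := prime_sub_center primeP.
have [noethb locb prime_u [bw _ _ _] nuw] := regular_parameters_beta ka; have subb := sub_beta ka.
rewrite (localize_localize sub_B primeP (prime_M ka) PM) -beta_localization //.
have facb : is_factorial (beta_ a) by apply: two_dimensional_factorial nuw.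
have multS : multiplicative_set (beta_ a) (fun s => B s /\ ~ P s).
  have [S1 S0 _ SM] := prime_complement_multiplicative_set sub_B primeP.
  by split=> // s [Bs _]; apply: Bs.
apply: factorial_krull; first exact: fractions_subring.
exact: factorial_fractions.
Qed.

Lemma intersection_not_noetherian : ~ is_noetherian B.
Proof.
move=> noethB; pose J (s : seq K) z := B z /\ forall a, k a -> a \notin s -> beta_ a (z / y).
have idJ s : is_ideal B (J s).
  split=> [z []//||b c [Bb Jb] [Bc Jc]|r b Br [Bb Jb]]; split; try by in_subring sub_B.
  - by move=> a /sub_beta subb _; rewrite mul0r; apply: subring0.
  - by move=> a ka sa; rewrite mulrDl; apply: (subringD (sub_beta ka)); [apply: Jb | apply: Jc].
  - by move=> a ka sa; rewrite -mulrA; apply: (subringM (sub_beta ka)); [apply: Br | apply: Jb].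
have dirJ s s' : exists l, (forall z, J s z -> J l z) /\ (forall z, J s' z -> J l z).
  exists (s ++ s'); split=> z [Bz Jz]; split=> // a ka; rewrite mem_cat negb_or => /andP [sa s'a].
    exact: Jz.
  exact: Jz.
have idU := directed_union_ideal [::] idJ dirJ.
have [s Js] := fin_gen_directed_union [::] idJ dirJ (noetherian_fin_gen sub_B noethB idU).
have [b kb bs] := alg_closed_infinite fieldk closedk s.
have wyE : w b / y = (u b)^-1 by rewrite wE // mulrC mulKf.
have [|_ /(_ b kb bs)] := Js [:: b] (w b); last by rewrite wyE; apply: beta_notin_param_inv.
split=> [|a ka]; first exact: B_w.
by rewrite inE wyE => ab; have [] := beta_unit_param ka kb ab.
Qed.

Lemma intersection_irredundant b : k b ->
  ~ (forall z, (forall a, k a -> a <> b -> beta_ a z) <-> B z).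
Proof.
move=> kb /(_ (u b)^-1) [uB _]; apply: (beta_notin_param_inv kb); apply: uB => // a ka /eqP ab.
by have [] := beta_unit_param ka kb ab.
Qed.

Lemma intersection_essential a : k a ->
  exists Q, is_prime_ideal B Q /\ forall z, beta_ a z <-> localize B Q z.
Proof.
by move=> ka; exists (M a); split=> [|z]; [apply: prime_M | rewrite -beta_localization].
Qed.

End Intersection.

Theorem theorem6p15 (K : fieldType) (D k : K -> Prop) (x y : K) :
  regular_local_dim2 D x y ->
  coefficient_field D (ideal2 D x y) k ->
  alg_closed_sub k ->
  let B := fun z => forall a, k a -> beta D x y a z in
  [/\ almost_krull B,
      ~ is_noetherian B,
      (* irredundant *)
      (forall b, k b ->
         ~ (forall z, (forall a, k a -> a <> b -> beta D x y a z) <-> B z)) &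
      (* essential *)
      (forall a, k a -> exists Q, is_prime_ideal B Q /\
                        forall z, beta D x y a z <-> localize B Q z)].
Proof.
move=> regD cfk closedk B; split.
- exact: (intersection_almost_krull regD cfk closedk).
- exact: (intersection_not_noetherian regD cfk closedk).
- by move=> b kb; apply: (intersection_irredundant regD cfk).
- by move=> a ka; apply: (intersection_essential regD cfk).
Qed.
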